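(* Let $K\in L^2([0,1]^2)$. The co-ordinate process $X\colon\Omega\to L^2([0,1])$ is a centered Gaussian process with Fredholm kernel $K$ if and only if $$ \mathbb{E}\left[X_t\,\mathrm{D}_t f(X)\right]=\mathbb{E}\left[\int_0^1 K(t,s)\,\mathrm{K}^*\!\left[\mathrm{D}^2_{t,\,\cdot\,}f(X)\right](s)\,\mathrm{d}s\right] $$ for all $t\in[0,1]$ and all smooth functionals $f\in\mathcal{S}$.
   Context: Setting: $\Omega=L^2=L^2([0,1])$ with its Borel $\sigma$-field, $\mathbb{P}$ is a probability measure on $\Omega$, $\mathbb{E}$ its expectation, and $X=(X_t)_{t\in[0,1]}$ is the co-ordinate process $X_t(\omega)=\omega(t)$. Fredholm kernel: $X$ is a centered Gaussian process with Fredholm kernel $K\in L^2([0,1]^2)$ if it is a centered Gaussian process with covariance $R(t,s)=\mathbb{E}[X_tX_s]=\int_0^1K(t,u)K(s,u)\,\mathrm{d}u$ (equivalently $X_t=\int_0^1K(t,s)\,\mathrm{d}W_s$ for some Brownian motion $W$). Step functions: $\mathbf{1}_t=\mathbf{1}_{[0,t)}$. $\mathcal{E}\subset L^2$ is the set of right-continuous step functions, i.e. finite linear combinations $e=\sum_j a_j\mathbf{1}_{u_j}$ with $u_j\in(0,1]$. For a path $x$ put $\int_0^1 e(t)\,\mathrm{d}x(t)=\sum_j a_j x(u_j)$, so that $\int_0^1\mathbf{1}_u(t)\,\mathrm{d}x(t)=x(u)$. Smooth functionals: $\mathcal{S}$ is the set of functionals $f\colon L^2\to\mathbb{C}$ of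 the form $f(x)=g(z_1,\dots,z_n)$, $z_k=\int_0^1e_k(t)\,\mathrm{d}x(t)$, where $n\in\mathbb{N}$, $e_k\in\mathcal{E}$, and $g\in\mathcal{C}^\infty_p(\mathbb{R}^n)$, i.e. $g$ is smooth and it and all its partial derivatives of all orders are polynomially bounded. Pathwise Malliavin derivatives: for such $f$, $\mathrm{D}_tf(x)=\sum_{k=1}^n\frac{\partial g}{\partial z_k}(z_1,\dots,z_n)\,e_k(t)$ and $\mathrm{D}^2_{t,s}f(x)=\sum_{k,l=1}^n\frac{\partial^2g}{\partial z_k\partial z_l}(z_1,\dots,z_n)\,e_k(t)e_l(s)$. Associated adjoint operator: $\mathrm{K}^*$ is defined by linearly extending $\mathrm{K}^*\mathbf{1}_t(s)=K(t,s)$; its domain $\mathrm{dom}(\mathrm{K}^* )$ is the Hilbert space generated by the indicators $\mathbf{1}_t$, closed under the inner product $\langle\mathbf{1}_t,\mathbf{1}_s\rangle=\int_0^1K(t,u)K(s,u)\,\mathrm{d}u$. In particular, for $e=\sum_ja_j\mathbf{1}_{u_j}\in\mathcal{E}$, $\mathrm{K}^*e=\sum_ja_jK(u_j,\cdot)$. In the formula $\mathrm{K}^*$ acts, for fixed $t$ and $\omega$, on the step function $s\mapsto\mathrm{D}^2_{t,s}f(X)$.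
   Formalization: The ''if'' direction is false at t=0 and t=1 (1_u vanishes at 1, and 0 is never a node), so it is stated on (0,1): the formula for t and nodes in (0,1) gives that X is Gaussian with kernel K over (0,1). The ''only if'' direction is kept on [0,1]. Existence of the integrals is part of both sides. *)

(* Defs.v *)
From HB Require Import structures.
From mathcomp Require Import all_boot all_order all_algebra.
From mathcomp Require Import complex.
From mathcomp Require Import all_classical all_reals all_analysis.
From mathcomp Require Import measurable_realfun.

Set Implicit Arguments.
Unset Strict Implicit.
Unset Printing Implicit Defensive.
Import Order.TTheory GRing.Theory Num.Theory.
Import numFieldNormedType.Exports.
Local Open Scope classical_set_scope.
Local Open Scope ring_scope.
Local Open Scope complex_scope.
Local Open Scope quotient_scope.

(** * The space L^2([0,1]) with its Borel sigma-field *)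

Lemma leb01_fin (R : realType) :
  (@lebesgue_measure R `[0%R, 1%R]%classic < +oo)%E.
Proof. by rewrite lebesgue_measure_itv/= lte01 oppr0 adde0 ltry. Qed.

(* Lebesgue measure on the line, carried by [0,1]. *)
Definition leb01 (R : realType) :
    {finite_measure set (measurableTypeR R) -> \bar R} :=
  @mfrestr _ (measurableTypeR R) R _ (@lebesgue_measure R)
    (measurable_itv `[0%R, 1%R]) (leb01_fin R).

(* Elements are classes of functions modulo Lebesgue-a.e. equality on [0,1];
   the coercion to functions picks an arbitrary representative. *)
Definition L2 (R : realType) : Type := LspaceType2 (leb01 R).

Lemma finite_norm_ae0 (R : realType) (d : measure_display)
    (T : measurableType d) (mu : {measure set T -> \bar R})
    (f : T -> R) : measurable_fun [set: T] f ->
  {ae mu, forall x, f x = 0} -> finite_norm mu 2%:E f.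
Proof.
move=> mf f0; rewrite /finite_norm unlock.
suff -> : (\int[mu]_x `|(EFin \o f) x| `^ 2 = 0)%E by rewrite poweR0r ?ltry// invr_eq0 pnatr_eq0.
rewrite -(@integral0 _ _ _ mu setT); apply: ae_eq_integral => //.
- have maf : measurable_fun [set: T] (abse \o (EFin \o f)).
    by apply: measurableT_comp => //; exact/measurable_EFinP.
  exact: (measurableT_comp (measurable_poweR (2 : R)) maf).
- apply: filterS f0 => x fx0 _ /=.
  by rewrite fx0 normr0 powR0// pnatr_eq0.
Qed.

Section L2_zero.
Variable R : realType.
Let mu := leb01 R.
Let zero : {mfun measurableTypeR R >-> measurableTypeR R} :=
  cst (0 : measurableTypeR R).

Definition L2_zero_class : {mfun_ mu, measurableTypeR R >-> measurableTypeR R} :=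
  \pi_({mfun_ mu, measurableTypeR R >-> measurableTypeR R}) zero.

Lemma L2_zero_finite : finite_norm mu 2%:E (L2_zero_class : _ -> R).
Proof.
pose f : {mfun measurableTypeR R >-> measurableTypeR R} := repr L2_zero_class.
have /eqmodP/asboolP h : f = zero
    %[mod {mfun_ mu, measurableTypeR R >-> measurableTypeR R}].
  by rewrite reprK.
apply: (@finite_norm_ae0 R _ (measurableTypeR R) mu f).
  exact: (@measurable_funPT _ _ _ _ f).
by apply: filterS h => x /(_ I).
Qed.

HB.instance Definition _ := @isFinLebesgue.Build _ _ R mu _ (lee1n 2)
  L2_zero_class L2_zero_finite.

Definition L2_zero : L2 R := L2_zero_class : LspaceType2 mu.
End L2_zero.

HB.instance Definition _ (R : realType) := gen_eqMixin (L2 R).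
HB.instance Definition _ (R : realType) := gen_choiceMixin (L2 R).
HB.instance Definition _ (R : realType) := isPointed.Build (L2 R) (L2_zero R).

Definition L2dist (R : realType) (x y : L2 R) : \bar R :=
  Lnorm (leb01 R) 2%:E (fun t => ((x t : R) - (y t : R))%:E).

Definition L2open (R : realType) : set (set (L2 R)) :=
  [set U | forall x, U x -> exists2 r : R, 0 < r &
    forall y, (L2dist x y < r%:E)%E -> U y].

Definition Omega (R : realType) := g_sigma_algebraType (@L2open R).

(* Since w : Omega R is a class, w(t) has no meaning for an individual t.
   "The co-ordinate process X_t(w) = w(t)" is a jointly measurable version of
   the evaluation: for every w, the path X_.(w) is a representative of w. *)
Definition coordinate_process (R : realType) (X : R -> Omega R -> R) : Prop :=
  measurable_fun ((`[0, 1] : set (measurableTypeR R)) `*` [set: Omega R])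
    (fun p : measurableTypeR R * Omega R => X p.1 p.2) /\
  forall w : Omega R, {ae leb01 R, forall t, X t w = (w : L2 R) t}.

(* A representative of an element of L^2([0,1]^2); its values outside the
   square are irrelevant up to measurability. *)
Definition L2kernel (R : realType) (K : R -> R -> R) : Prop :=
  (fun p : measurableTypeR R * measurableTypeR R => K p.1 p.2)
    \in Lfun (leb01 R \x leb01 R)%E 2%:E.

(** * Centered Gaussian processes *)

Section Gaussian.
Variables (R : realType) (d : measure_display) (T : measurableType d).
Variable P : probability T R.

(* [normal_prob 0 s] is the normal law only for [s != 0]; the degenerate
   centered Gaussian law is the Dirac mass at 0. *)
Definition centered_gaussian_rv (Y : T -> R) : Prop :=
  measurable_fun [set: T] Y /\
  ((forall A : set (measurableTypeR R), measurable A ->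
      pushforward P (Y : T -> measurableTypeR R) A = \d_(0 : R) A) \/
   exists2 s : R, 0 < s &
    forall A : set (measurableTypeR R), measurable A ->
      pushforward P (Y : T -> measurableTypeR R) A = normal_prob 0 s A).

Definition centered_gaussian_process (I : set R) (X : R -> T -> R) : Prop :=
  forall (n : nat) (t : 'I_n -> R) (a : 'I_n -> R), (forall i, I (t i)) ->
    centered_gaussian_rv (fun w => \sum_(i < n) a i * X (t i) w).

Definition gaussian_with_fredholm_kernel
    (I : set R) (K : R -> R -> R) (X : R -> T -> R) : Prop :=
  centered_gaussian_process I X /\
  forall t s, I t -> I s ->
    (@lebesgue_measure R).-integrable `[0, 1] (fun u => (K t u * K s u)%:E) /\
    ('E_P[fun w => (X t w * X s w)%R])%E =
      (\int[@lebesgue_measure R]_(u in `[0%R, 1%R]) (K t u * K s u)%:E)%E.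

End Gaussian.

(** * Complex-valued integrals *)

Section ComplexIntegral.
Variables (R : realType) (d : measure_display) (T : measurableType d).
Variables (mu : {measure set T -> \bar R}) (D : set T).

Definition cintegrable (f : T -> R[i]) : Prop :=
  mu.-integrable D (fun x => (complex.Re (f x))%:E) /\
  mu.-integrable D (fun x => (complex.Im (f x))%:E).

Definition cintegral (f : T -> R[i]) : R[i] :=
  Rintegral mu D (fun x => complex.Re (f x)) +i*
  Rintegral mu D (fun x => complex.Im (f x)).

End ComplexIntegral.

(** * Step functions *)

Section Step.
Variable R : realType.

(* [:: (a_1, u_1); ...] stands for a_1 1_[0,u_1) + ... *)
Definition step (F : Type) := seq (F * R).

Definition step_nodes (F : eqType) (I : set R) (e : step F) : Prop :=
  forall p, p \in e -> I p.2.

Definition step_val (F : nmodType) (e : step F) (t : R) : F :=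
  \sum_(p <- e) p.1 *+ (t \in `[0, p.2[).

(* The linear extension of 1_u |-> phi u. *)
Definition step_lin (F : nzRingType) (phi : R -> F) (e : step F) : F :=
  \sum_(p <- e) p.1 * phi p.2.

(* [step_lin] only depends on the step function, not on the way it is
   written. *)
Section Wd.
Variables (F : nzRingType).

Let coef (e : step F) (u : R) : F := \sum_(p <- e | p.2 == u) p.1.

Let coefE (e : step F) (u v : R) : 0 <= v -> v < u ->
  (forall p, p \in e -> p.2 < u -> p.2 <= v) ->
  step_val e v - step_val e u = coef e u.
Proof.
move=> v0 vu h; rewrite /step_val /coef -sumrB [RHS]big_mkcond /= big_seq.
rewrite [RHS]big_seq; apply: eq_bigr => p pe.
rewrite !in_itv /= v0 (ltW (le_lt_trans v0 vu)) /=.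
case: (ltgtP p.2 u) => [pu|up|->].
- by rewrite ltNge h //= subrr.
- by rewrite (lt_trans vu up) subrr.
- by rewrite vu subr0.
Qed.

Let coef_eq (e e' : step F) (u : R) : 0 < u ->
  step_val e =1 step_val e' -> coef e u = coef e' u.
Proof.
move=> u0 ee.
pose v := \big[Order.max/(0 : R)]_(p <- e ++ e' | p.2 < u) p.2.
have v0 : 0 <= v by exact: bigmax_ge_id.
have vu : v < u.
  rewrite /v; apply: (big_ind (fun x => x < u)) => //= x y xu yu.
  by rewrite gt_max xu.
have h p : p \in e ++ e' -> p.2 < u -> p.2 <= v.
  by move=> pe pu; exact: (@le_bigmax_seq _ _ _ _ 0 p (fun q => q.2 < u) snd).
rewrite -(coefE v0 vu) ?ee; last first.
  by move=> p pe; apply: h; rewrite mem_cat pe.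
by rewrite coefE// => p pe; apply: h; rewrite mem_cat pe orbT.
Qed.

Let step_linE (phi : R -> F) (e : step F) (r : seq R) :
  uniq r -> {subset [seq p.2 | p <- e] <= r} ->
  step_lin phi e = \sum_(u <- r) coef e u * phi u.
Proof.
move=> ur er; rewrite /coef.
under eq_bigr do rewrite mulr_suml big_mkcond.
rewrite exchange_big /= /step_lin big_seq [RHS]big_seq.
apply: eq_bigr => p pe; rewrite (bigD1_seq p.2) //=; last first.
  by apply: er; apply/mapP; exists p.
rewrite eqxx big1 ?addr0// => u; rewrite eq_sym.
by case: eqP.
Qed.

Lemma step_lin_wd (phi : R -> F) (e e' : step F) :
  (forall p, p \in e ++ e' -> 0 < p.2) ->
  step_val e =1 step_val e' -> step_lin phi e = step_lin phi e'.
Proof.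
move=> pos ee; pose r := undup [seq p.2 | p <- e ++ e'].
rewrite !(@step_linE _ _ r) ?undup_uniq//.
- rewrite big_seq [RHS]big_seq; apply: eq_bigr => u.
  rewrite mem_undup => /mapP[p /pos p0 ->]; congr (_ * _).
  exact: coef_eq.
- by move=> u; rewrite mem_undup map_cat mem_cat => ->; rewrite orbT.
- by move=> u; rewrite mem_undup map_cat mem_cat => ->.
Qed.
End Wd.

(* int_0^1 e(t) dx(t) *)
Definition step_int (e : step R) (x : R -> R) : R := step_lin x e.

(* K^* e (s) *)
Definition Kstar (K : R -> R -> R) (e : step R[i]) (s : R) : R[i] :=
  step_lin (fun u => (K u s)%:C) e.

End Step.

(** * Smooth functionals and their pathwise Malliavin derivatives *)

Section Smooth.
Variables (R : realType) (n : nat).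

Definition partial (k : 'I_n) (h : 'rV[R]_n -> R) : 'rV[R]_n -> R :=
  fun z => 'D_(delta_mx 0 k) h z.

Definition iter_partial (s : seq 'I_n) (h : 'rV[R]_n -> R) : 'rV[R]_n -> R :=
  foldr partial h s.

Definition smooth_poly (h : 'rV[R]_n -> R) : Prop :=
  forall s : seq 'I_n,
    [/\ continuous (iter_partial s h),
        forall k z, derivable (iter_partial s h) z (delta_mx 0 k) &
        exists (C : R) (m : nat), forall z,
          `|iter_partial s h z| <= C * (1 + `|z|) ^+ m].

Definition csmooth_poly (g : 'rV[R]_n -> R[i]) : Prop :=
  smooth_poly (fun z => complex.Re (g z)) /\
  smooth_poly (fun z => complex.Im (g z)).

Definition cpartial (k : 'I_n) (g : 'rV[R]_n -> R[i]) : 'rV[R]_n -> R[i] :=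
  fun z => partial k (fun y => complex.Re (g y)) z +i*
           partial k (fun y => complex.Im (g y)) z.

Variables (g : 'rV[R]_n -> R[i]) (e : 'I_n -> step R R).

Definition zvec (x : R -> R) : 'rV[R]_n := \row_k step_int (e k) x.

(* The functional f itself; only its derivatives enter the formula. *)
Definition sfun (x : R -> R) : R[i] := g (zvec x).

Definition Dfun (t : R) (x : R -> R) : R[i] :=
  \sum_(k < n) cpartial k g (zvec x) * (step_val (e k) t)%:C.

(* s |-> D^2_{t,s} f(x), as a (complex) step function; see [D2funE]. *)
Definition D2fun (t : R) (x : R -> R) : step R R[i] :=
  [seq ((\sum_(k < n) cpartial k (cpartial l g) (zvec x) *
           (step_val (e k) t)%:C) * (p.1)%:C, p.2)
     | l <- enum 'I_n, p <- e l].

Lemma D2funE t x s : step_val (D2fun t x) s =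
  \sum_(k < n) \sum_(l < n) cpartial k (cpartial l g) (zvec x) *
    (step_val (e k) t)%:C * (step_val (e l) s)%:C.
Proof.
rewrite exchange_big /= /step_val /D2fun big_allpairs_dep /= big_enum /=.
apply: eq_bigr => l _; rewrite -mulr_suml.
rewrite raddf_sum /= mulr_sumr; apply: eq_bigr => p _.
by rewrite raddfMn /= mulrnAr.
Qed.

End Smooth.

(** * The integration by parts formula *)

(* I is the set of times at which the path is read, both for X_t and for the
   nodes of the step functions defining f. Equality of two expectations is
   understood to include that all the integrals involved exist.
   Over I = [0,1] the formula does not control the endpoints: every 1_u with
   u in (0,1] vanishes at t = 1, so that it is 0 = 0 there, and 0 is not a
   node, so that E[X_0^2] and the integral of K(0,.)^2 never occur in it. *)
Definition malliavin_ibp (R : realType) (d : measure_display)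
    (T : measurableType d) (P : probability T R)
    (I : set R) (K : R -> R -> R) (X : R -> T -> R) : Prop :=
  forall t, I t ->
  forall (n : nat) (g : 'rV[R]_n -> R[i]) (e : 'I_n -> step R R),
    csmooth_poly g ->
    (forall k, step_nodes (I `&` `]0, 1]) (e k)) ->
    let lhs w := (X t w)%:C * Dfun g e t (X ^~ w) in
    let integrand w s := (K t s)%:C * Kstar K (D2fun g e t (X ^~ w)) s in
    let rhs w := cintegral (@lebesgue_measure R) `[0, 1] (integrand w) in
    [/\ cintegrable P setT lhs,
        {ae P, forall w,
           cintegrable (@lebesgue_measure R) `[0, 1] (integrand w)},
        cintegrable P setT rhs &
        cintegral P setT lhs = cintegral P setT rhs].

(* Main.v *)
(* Gaussian => formula: for a jointly Gaussian vector (Y, Z) with c_l = E[Y Z_l],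
   the formula reduces, after pulling the covariances out of the integral in s,
   to E[Y h(Z)] = sum_l c_l E[D_l h(Z)] for h a partial derivative of g (and to
   the symmetry of second derivatives). For h(z) = cos(lam.z) or sin(lam.z) this
   is the derivative at 0 of the one-dimensional characteristic function
   eps |-> E[exp(i (lam.Z + eps Y))]. The general case follows by density:
   h(L sin(z_1/L), ..., L sin(z_n/L)) tends to h(z) as L -> oo, with its gradient
   and without losing polynomial bounds, and on the box [-L, L]^n the function h
   and its gradient are limits of Bernstein polynomials, so that one is left with
   trigonometric polynomials in z. No integral over R^n is needed.

   Formula => Gaussian: functionals of a single W = int e dX suffice. Quadratic
   ones give the covariances; trigonometric ones give, for e(t) <> 0 and then for
   all e by perturbing e with (1/m) 1_v, v > t, the identity
   E[X_t exp(i lam W)] = i lam Cov(X_t, W) E[exp(i lam W)]. Summing over the nodes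
   of e, the characteristic function of W solves the Gaussian differential
   equation, and the approximation scheme above shows that it determines the law
   of W. *)
Require Import Defs.
From HB Require Import structures.
From mathcomp Require Import all_boot all_order all_algebra.
From mathcomp Require Import ring lra.
From mathcomp Require Import complex.
From mathcomp Require Import all_classical all_reals all_analysis.
From mathcomp Require Import measurable_realfun.

Set Implicit Arguments.
Unset Strict Implicit.
Unset Printing Implicit Defensive.
Import Order.TTheory GRing.Theory Num.Theory.
Import numFieldNormedType.Exports.
Local Open Scope classical_set_scope.
Local Open Scope ring_scope.

(** * Integrals of real-valued functions *)

(** Bernstein polynomials are evaluated at theta = (1 + sin (z / L)) / 2, which stays in [0, 1]: a
    polynomial in theta is a trigonometric polynomial in z, and L (2 theta - 1) = L sin (z / L).
    Functions of n variables are approximated one coordinate at a time, so that only one-dimensional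
    Bernstein estimates occur, with coefficients that are functions of the remaining coordinates.

    The obstacle is that Stein's identity is linear in the functional and not stable under products.
    It is therefore proved from the start against an arbitrary trigonometric factor; the
    product-to-sum formulas let this factor absorb theta. Equality of expectations under two laws is
    handled by the same device.

    The characteristic function of the normal law comes from the same differential equation:
    integration by parts against the density is the one-dimensional Stein identity.

    In the converse, the factor e(t) on both sides of the formula can be cancelled only where it is
    nonzero, and the existence clauses matter as well: the almost sure one yields the integrability
    of K(t,.) K(u,.). *)

Section RealIntegral.
Context d (T : measurableType d) (R : realType).
Variables (mu : {measure set T -> \bar R}) (D : set T).
Hypothesis mD : measurable D.
Implicit Types f g : T -> R.

Definition rintegrable f := mu.-integrable D (EFin \o f).

Lemma rintegrableD f g : rintegrable f -> rintegrable g ->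
  rintegrable (fun x => f x + g x).
Proof. by move=> If Ig; exact: (integrableD mD If Ig). Qed.

Lemma rintegrableZ a f : rintegrable f -> rintegrable (fun x => a * f x).
Proof. by move=> If; exact: (integrableZl mD a If). Qed.

Lemma rintegrable_sum (I : eqType) (s : seq I) (h : I -> T -> R) :
  (forall i, i \in s -> rintegrable (h i)) ->
  rintegrable (fun x => \sum_(i <- s) h i x).
Proof.
move=> Ih; have := @integrable_sum _ _ _ mu D mD I s (mem s)
  (fun i => EFin \o h i) Ih.
by apply: eq_integrable => // x _; rewrite /= sumEFin -big_seq.
Qed.

Lemma Rintegral_sum (I : eqType) (s : seq I) (h : I -> T -> R) :
  (forall i, i \in s -> rintegrable (h i)) ->
  \int[mu]_(x in D) (\sum_(i <- s) h i x) =
  \sum_(i <- s) \int[mu]_(x in D) h i x.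
Proof.
elim: s => [|i s IHs] Ih.
  by under eq_Rintegral do rewrite big_nil; rewrite big_nil Rintegral_cst// mul0r.
have Is k : k \in s -> rintegrable (h k) by move=> ks; apply: Ih; rewrite inE ks orbT.
under eq_Rintegral do rewrite big_cons.
rewrite big_cons RintegralD// ?IHs//; last exact: rintegrable_sum.
by apply: Ih; rewrite mem_head.
Qed.

Lemma rintegrable_le f g : measurable_fun D f ->
  (forall x, D x -> `|f x| <= g x) -> rintegrable g -> rintegrable f.
Proof.
move=> mf fg Ig; apply: (@le_integrable _ _ _ mu D mD _ (EFin \o g)) => //.
  exact/measurable_EFinP.
by move=> x Dx; rewrite /= lee_fin (le_trans (fg _ Dx))// ler_norm.
Qed.

Lemma rintegrable_measurable f : rintegrable f -> measurable_fun D f.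
Proof. by move=> /(@measurable_int _ _ _ mu)/measurable_EFinP. Qed.

Lemma rintegrable_norm f : rintegrable f -> rintegrable (fun x => `|f x|).
Proof.
move=> If; apply: (@le_integrable _ _ _ mu D mD _ (EFin \o f)) => //.
  by apply/measurable_EFinP/measurableT_comp => //; exact: rintegrable_measurable.
by move=> x Dx; rewrite /= lee_fin normr_id.
Qed.

Lemma rdominated_cvg (f_ : nat -> T -> R) f g :
  (forall n, measurable_fun D (f_ n)) ->
  (forall x, D x -> f_ n x @[n --> \oo] --> f x) ->
  (forall n x, D x -> `|f_ n x| <= g x) -> rintegrable g ->
  rintegrable f /\
  \int[mu]_(x in D) f_ n x @[n --> \oo] --> \int[mu]_(x in D) f x.
Proof.
move=> mf_ f_f f_g Ig.
have mf : measurable_fun D f by exact: (measurable_fun_cvg mf_ f_f).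
have [|||||I1 _ I3] := @dominated_convergence _ _ _ mu D mD
  (fun n => EFin \o f_ n) (EFin \o f) (EFin \o g).
- by move=> n; exact/measurable_EFinP.
- exact/measurable_EFinP.
- by apply: aeW => x Dx; apply: cvg_EFin; [exact: nearW|exact: f_f].
- exact: Ig.
- by apply: aeW => x n Dx; rewrite /= lee_fin f_g.
split=> //; apply: fine_cvg.
by rewrite fineK//; exact: integrable_fin_num.
Qed.

End RealIntegral.

Section FiniteIntegral.
Context d (T : measurableType d) (R : realType).
Variables (P : {finite_measure set T -> \bar R}).

Lemma rintegrable_bounded (f : T -> R) (M : R) : measurable_fun setT f ->
  (forall x, `|f x| <= M) -> rintegrable P setT f.
Proof.
move=> mf fM; apply: (@rintegrable_le _ _ _ P _ _ f (cst M)) => //.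
exact: (finite_measure_integrable_cst P M).
Qed.

End FiniteIntegral.

Lemma Rintegral_probability_cst d (T : measurableType d) (R : realType)
  (P : probability T R) (r : R) : \int[P]_(w in setT) r = r.
Proof.
rewrite Rintegral_cst// -[RHS]mulr1; congr (_ * _).
rewrite -[RHS]/(fine 1%E); congr fine; exact: probability_setT.
Qed.

(** * Bernstein polynomials *)

Section Bernstein.
Variable R : realType.
Implicit Types (f g : nat -> R) (x c : R) (n : nat).

(* [\sum_(j <= n) 'C(n, j) x^j (1 - x)^(n - j) f j], through its Pascal
   recursion, which spares the binomial identities. *)
Fixpoint bernstein n f x : R :=
  if n is m.+1 then x * bernstein m (f \o succn) x + (1 - x) * bernstein m f x
  else f 0%N.

(** The derivative of [bernstein n f] in x, by the product rule applied to the recursion. *)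
Fixpoint dbernstein n f x : R :=
  if n is m.+1 then bernstein m (f \o succn) x - bernstein m f x +
    (x * dbernstein m (f \o succn) x + (1 - x) * dbernstein m f x)
  else 0.

Lemma bernsteinD n f g x :
  bernstein n (fun j => f j + g j) x = bernstein n f x + bernstein n g x.
Proof. by elim: n f g => //= n IHn f g; rewrite !IHn; ring. Qed.

Lemma bernsteinZ n c f x :
  bernstein n (fun j => c * f j) x = c * bernstein n f x.
Proof. by elim: n f => //= n IHn f; rewrite !IHn; ring. Qed.

Lemma bernsteinZr n c f x :
  bernstein n (fun j => f j * c) x = bernstein n f x * c.
Proof. by elim: n f => //= n IHn f; rewrite !IHn; ring. Qed.

Lemma bernstein_cst n c x : bernstein n (fun=> c) x = c.
Proof. by elim: n => //= n IHn; rewrite !IHn; ring. Qed.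

(** Second moment of a binomial variable about c: squared bias plus variance. An arbitrary center
    makes the induction work, since the shift of j by one replaces c by c - 1. *)
Lemma bernstein_variance n c x :
  bernstein n (fun j => (j%:R - c) ^+ 2) x =
  (n%:R * x - c) ^+ 2 + n%:R * (x * (1 - x)).
Proof.
elim: n c => [|n IHn] c /=; first by ring.
have -> : (fun j => (j%:R - c) ^+ 2) \o succn = fun j => (j%:R - (c - 1)) ^+ 2.
  by apply/funext => j /=; rewrite -natr1; ring.
by rewrite !IHn -natr1; ring.
Qed.

Lemma ler_bernstein n f g x : 0 <= x <= 1 ->
  (forall j, (j <= n)%N -> f j <= g j) -> bernstein n f x <= bernstein n g x.
Proof.
move=> /[dup] x01 /andP[x0 x1]; elim: n f g => [|n IHn] f g fg /=; first exact: fg.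
apply: lerD; apply: ler_wpM2l; rewrite ?subr_ge0//; apply: IHn => j jn /=.
  exact: fg.
by apply: fg; exact: leqW.
Qed.

Lemma bernstein_norm_le n f x c : 0 <= x <= 1 ->
  (forall j, (j <= n)%N -> `|f j| <= c) -> `|bernstein n f x| <= c.
Proof.
move=> x01 fc; rewrite ler_norml -[X in X <= _ <= _](bernstein_cst n _ x).
rewrite -{2}(bernstein_cst n c x) !ler_bernstein// => j /fc.
  by rewrite ler_norml => /andP[].
by rewrite ler_norml => /andP[].
Qed.

(** The derivative is again a Bernstein polynomial, of the scaled forward differences; convergence
    of derivatives thus falls under [bernstein_cvg]. *)
Lemma dbernsteinS n f x :
  dbernstein n.+1 f x = bernstein n (fun j => n.+1%:R * (f j.+1 - f j)) x.
Proof.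
have B m (g h : nat -> R) :
    bernstein m (fun j => g j - h j) x = bernstein m g x - bernstein m h x.
  by elim: m g h => //= m IHm g h; rewrite !IHm; ring.
rewrite bernsteinZ B; elim: n f => [|n IHn] f; first by rewrite /=; ring.
have -> : dbernstein n.+2 f x = bernstein n.+1 (f \o succn) x - bernstein n.+1 f x +
  (x * dbernstein n.+1 (f \o succn) x + (1 - x) * dbernstein n.+1 f x) by [].
by rewrite !IHn /= -[n.+2%:R]natr1; rewrite /comp; ring.
Qed.

(** Chebyshev's argument. The coefficients form an array and need not sample a fixed function, so
    that difference quotients are covered along with values. *)
Lemma bernstein_cvg (f : nat -> nat -> R) (v M x : R) : 0 <= x <= 1 ->
  (forall n j, (j <= n)%N -> `|f n j| <= M) ->
  (forall e : R, 0 < e -> exists2 r : R, 0 < r & \forall n \near \oo, forall j,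
     (j <= n)%N -> `|j%:R / n%:R - x| < r -> `|f n j - v| <= e) ->
  bernstein n (f n) x @[n --> \oo] --> v.
Proof.
move=> x01 fM fv; apply/cvgrPdist_le => e e0.
have e20 : 0 < e / 2 by rewrite divr_gt0.
have [r r0 fr] := fv _ e20.
have M0 : 0 <= M by rewrite (le_trans _ (fM 0%N 0%N _)).
pose C := (M + `|v|) / r ^+ 2.
have C0 : 0 <= C by rewrite divr_ge0 ?addr_ge0// sqr_ge0.
have Hn : \forall n \near \oo, C / n%:R <= e / 2 :> R.
  near=> n; have n0 : 0 < n%:R :> R by rewrite ltr0n; near: n; exists 1%N.
  rewrite ler_pdivrMr// mulrC -ler_pdivrMr//.
  by near: n; exact: nbhs_infty_ger.
near=> n.
have n0 : 0 < n%:R :> R by rewrite ltr0n; near: n; exists 1%N.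
have frn : forall j, (j <= n)%N -> `|j%:R / n%:R - x| < r -> `|f n j - v| <= e / 2.
  by near: n.
have Hnn : C / n%:R <= e / 2 by near: n.
rewrite distrC -{1}(bernstein_cst n v x) -mulN1r -bernsteinZ -bernsteinD.
(* A quadratic majorant of |f n j - v|: within r of x the term e / 2 suffices, elsewhere the second
   term is at least M + |v| by the choice of C. By the variance formula its Bernstein value at x is
   e / 2 + (C / n) x (1 - x). *)
pose g (j : nat) : R := e / 2 + C / n%:R ^+ 2 * (j%:R - n%:R * x) ^+ 2.
have fg j : (j <= n)%N -> `|f n j + -1 * v| <= g j.
  move=> jn; rewrite mulN1r; have [jr|rj] := ltP `|j%:R / n%:R - x| r.
    apply: (@le_trans _ _ (e / 2)); first exact: frn.
    by rewrite /g/= lerDl mulr_ge0 ?sqr_ge0// divr_ge0// sqr_ge0.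
  have : `|f n j - v| <= M + `|v|.
    by rewrite (le_trans (ler_normB _ _))// lerD// fM.
  move=> /le_trans; apply.
  rewrite /g -[leLHS]add0r lerD ?(ltW e20)//.
  have -> : C / n%:R ^+ 2 * (j%:R - n%:R * x) ^+ 2 = C * (j%:R / n%:R - x) ^+ 2.
    by field; rewrite gt_eqF.
  rewrite /C mulrAC -mulrA ler_peMr ?addr_ge0//.
  rewrite -expr_div_n -[_ ^+ 2]ger0_norm ?sqr_ge0// normrX exprn_ege1//.
  by rewrite normrM normfV (gtr0_norm r0) ler_pdivlMr// mul1r.
have gle : bernstein n g x <= e.
  rewrite bernsteinD bernstein_cst bernsteinZ bernstein_variance subrr expr0n add0r.
  rewrite [leRHS]splitr lerD2l (le_trans _ Hnn)//.
  have -> : C / n%:R ^+ 2 * (n%:R * (x * (1 - x))) = C / n%:R * (x * (1 - x)).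
    by field; rewrite gt_eqF.
  have x1 : x * (1 - x) <= 1 by move/andP: x01 => [? ?]; nra.
  by rewrite ler_piMr// divr_ge0// ltW.
rewrite (le_trans _ gle)// ler_norml -[X in X <= _]mulN1r -bernsteinZ.
by rewrite !ler_bernstein// => j /fg; rewrite ler_norml ?mulN1r => /andP[].
Unshelve. all: by end_near. Qed.

Lemma bernstein_continuous_cvg (h : R -> R) (M x : R) : 0 <= x <= 1 ->
  (forall t, 0 <= t <= 1 -> `|h t| <= M) -> {for x, continuous h} ->
  bernstein n (fun j => h (j%:R / n%:R)) x @[n --> \oo] --> h x.
Proof.
move=> x01 hM hx; apply: (bernstein_cvg (M := M)) => //.
  move=> n j jn; apply: hM; rewrite divr_ge0//=.
  (* For n = 0 the node j / n is 0, as the inverse of 0 is 0. *)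
  case: n jn => [|n jn]; first by rewrite invr0 mulr0.
  by rewrite ler_pdivrMr ?ltr0n// mul1r ler_nat.
move=> e e0; have /cvgrPdist_le/(_ _ e0)[r /= r0 hr] := hx.
exists r => //; apply: nearW => n j jn jr; rewrite distrC; apply: hr => /=.
by rewrite distrC.
Qed.

Lemma difference_quotientE (h h' : R -> R) n j : (j <= n)%N ->
  (forall t : R, is_derive t 1 h (h' t)) ->
  exists2 c, j%:R / n.+1%:R <= c <= j.+1%:R / n.+1%:R &
    n.+1%:R * (h (j.+1%:R / n.+1%:R) - h (j%:R / n.+1%:R)) = h' c.
Proof.
move=> jn dh; have n0 : 0 < n.+1%:R :> R by rewrite ltr0n.
have lt_node : j%:R / n.+1%:R < j.+1%:R / n.+1%:R :> R.
  by rewrite ltr_pM2r ?invr_gt0// ltr_nat.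
have [|c cj ->] := MVT lt_node (fun t _ => dh t).
  by apply: derivable_within_continuous => t _; exact: ex_derive.
exists c; first by move: cj; rewrite in_itv/= => /andP[/ltW-> /ltW->].
by rewrite -mulrBl -[j.+1%:R]natr1 addrAC subrr add0r mul1r mulrCA divff ?mulr1//.
Qed.

Lemma dbernstein_norm_le n (h h' : R -> R) (M x : R) : 0 <= x <= 1 ->
  (forall t : R, is_derive t 1 h (h' t)) ->
  (forall t, 0 <= t <= 1 -> `|h' t| <= M) ->
  `|dbernstein n (fun j => h (j%:R / n%:R)) x| <= M.
Proof.
move=> x01 dh h'M; case: n => [|n].
  by rewrite /= normr0 (le_trans _ (h'M 0 _))// lexx ler01.
rewrite dbernsteinS; apply: bernstein_norm_le => // j jn.
have [c /andP[jc cj] ->] := difference_quotientE jn dh.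
apply: h'M; rewrite (le_trans _ jc) ?divr_ge0//= (le_trans cj)//.
by rewrite ler_pdivrMr ?ltr0n// mul1r ler_nat.
Qed.

Lemma dbernstein_cvg (h h' : R -> R) (M x : R) : 0 <= x <= 1 ->
  (forall t : R, is_derive t 1 h (h' t)) ->
  (forall t, 0 <= t <= 1 -> `|h' t| <= M) -> {for x, continuous h'} ->
  dbernstein n (fun j => h (j%:R / n%:R)) x @[n --> \oo] --> h' x.
Proof.
move=> x01 dh h'M hx; rewrite -cvg_shiftS.
under eq_fun do rewrite dbernsteinS.
apply: (bernstein_cvg (M := M)) => //.
  move=> n j jn; have [c /andP[jc cj] ->] := difference_quotientE jn dh.
  apply: h'M; rewrite (le_trans _ jc) ?divr_ge0//= (le_trans cj)//.
  by rewrite ler_pdivrMr ?ltr0n// mul1r ler_nat.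
move=> e e0; have /cvgrPdist_le/(_ _ e0)[r /= r0 hr] := hx.
have r20 : 0 < r / 2 by rewrite divr_gt0.
exists (r / 2) => //; near=> n => j jn jr.
have n0 : 0 < n%:R :> R by rewrite ltr0n; near: n; exists 1%N.
have n1 : n.+1%:R ^-1 < r / 2.
  by near: n; exact: near_infty_natSinv_lt (PosNum r20).
have [c /andP[jc cj] ->] := difference_quotientE jn dh.
rewrite distrC; apply: hr => /=.
have n10 : 0 < n.+1%:R :> R by rewrite ltr0n.
have jn1 : j%:R <= n%:R :> R by rewrite ler_nat.
(* The node j / n lies between j / (n + 1) and (j + 1) / (n + 1), as c does, so the two differ by at
   most 1 / (n + 1). *)
have jj : j%:R / n.+1%:R <= j%:R / n%:R :> R.
  by rewrite ler_wpM2l// lef_pV2 ?posrE// ler_nat.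
have jj1 : j%:R / n%:R <= j.+1%:R / n.+1%:R :> R.
  rewrite ler_pdivrMr// mulrAC ler_pdivlMr// -[j.+1%:R]natr1 -[n.+1%:R]natr1.
  by rewrite mulrDr mulrDl mulr1 mul1r lerD2l.
have cjn : `|j%:R / n%:R - c| <= n.+1%:R ^-1.
  have -> : n.+1%:R ^-1 = j.+1%:R / n.+1%:R - j%:R / n.+1%:R :> R.
    by rewrite -mulrBl -[j.+1%:R]natr1 addrAC subrr add0r mul1r.
  move: jc cj jj jj1; move: (j%:R / n.+1%:R) (j.+1%:R / n.+1%:R) (j%:R / n%:R) => *.
  by rewrite ler_norml; apply/andP; split; lra.
rewrite (le_lt_trans (ler_distD (j%:R / n%:R) _ _))// [ltRHS]splitr.
by rewrite ltrD// ?(le_lt_trans cjn)// distrC.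
Unshelve. all: by end_near. Qed.

End Bernstein.

(** * Characteristic functions of Gaussian laws *)

Lemma normr_cos_le1 (R : realType) (x : R) : `|cos x| <= 1.
Proof. by rewrite ler_norml cos_geN1 cos_le1. Qed.

Lemma normr_sin_le1 (R : realType) (x : R) : `|sin x| <= 1.
Proof. by rewrite ler_norml sin_geN1 sin_le1. Qed.

Lemma measurable_cos (R : realType) : measurable_fun setT (@cos R).
Proof. by apply: continuous_measurable_fun => x; exact: continuous_cos. Qed.

Lemma measurable_sin (R : realType) : measurable_fun setT (@sin R).
Proof. by apply: continuous_measurable_fun => x; exact: continuous_sin. Qed.

(** * Change of variables along the law of a random variable *)

Section Law.
Context d (T : measurableType d) (R : realType).
Variables (P : probability T R) (Y : T -> measurableTypeR R).
Hypothesis mY : measurable_fun setT Y.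
Variable nu : {measure set (measurableTypeR R) -> \bar R}.
Hypothesis lawY : forall A : set (measurableTypeR R), measurable A ->
  pushforward P Y A = nu A.
Variables (g : measurableTypeR R -> R) (mg : measurable_fun setT g).
Hypothesis ig : rintegrable nu setT g.

Lemma rintegrable_law : rintegrable P setT (g \o Y).
Proof.
apply/integrableP; split; first exact/measurable_EFinP/measurableT_comp.
have /integrableP[_] := ig; apply: le_lt_trans.
rewrite -(@ge0_integral_pushforward _ _ _ _ _ _ mY P setT
  (fun x => `|(g x)%:E|%E))//; last first.
  by apply: measurableT_comp => //; exact/measurable_EFinP.
rewrite le_eqVlt; apply/orP; left; apply/eqP.
by apply: eq_measure_integral => A mA _; exact: lawY.
Qed.

Lemma Rintegral_law : \int[P]_w g (Y w) = \int[nu]_x g x.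
Proof.
rewrite /Rintegral; congr fine.
transitivity (\int[pushforward P Y]_x (g x)%:E)%E; last first.
  by apply: eq_measure_integral => A mA _; exact: lawY.
rewrite (@integral_pushforward _ _ _ _ _ _ mY P setT (EFin \o g))//.
  exact/measurable_EFinP.
exact: rintegrable_law.
Qed.

End Law.

(** * Differentiation of characteristic functions under the expectation *)

Section DifferentiateCos.
Context d (T : measurableType d) (R : realType).
Variables (P : probability T R) (V W : T -> R).
Hypotheses (mV : measurable_fun setT V) (iW : rintegrable P setT W).

Lemma is_derive_expectation_cos (t : R) :
  is_derive t 1 (fun t => \int[P]_w cos (V w + t * W w))
    (- \int[P]_w (W w * sin (V w + t * W w))).
Proof.
have mW : measurable_fun setT W by exact: rintegrable_measurable iW.
have mVW s : measurable_fun setT (fun w => V w + s * W w).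
  by apply: measurable_funD => //; exact: measurable_funM.
have dcos (s : R) w : is_derive s 1 (fun t => cos (V w + t * W w))
    (- (W w * sin (V w + s * W w))).
  apply: is_derive_eq; rewrite !scaler0 /GRing.scale/=.
  by ring.
have tI : (`]t - 1, t + 1[%classic : set R) t.
  by rewrite /= in_itv/=; apply/andP; split; lra.
have I1 (s : R) : `]t - 1, t + 1[%classic s ->
    P.-integrable setT (EFin \o (fun w => cos (V w + s * W w))).
  move=> _; apply: (@rintegrable_bounded _ _ _ P _ 1).
    exact: (measurableT_comp (@measurable_cos R) (mVW s)).
  by move=> w; rewrite normr_cos_le1.
have I2 (s : R) w : `]t - 1, t + 1[%classic s -> [set: T] w ->
    derivable (fun s : R => cos (V w + s * W w)) s 1.
  by move=> _ _; have [] := dcos s w.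
have dE (s : R) w : partial1of2 (fun (s : R) w => cos (V w + s * W w)) s w =
    - (W w * sin (V w + s * W w)).
  by rewrite partial1of2E; apply: derive_val.
have I3 (s : R) w : `]t - 1, t + 1[%classic s -> [set: T] w ->
    `|partial1of2 (fun (s : R) w => cos (V w + s * W w)) s w| <= `|W w|.
  by move=> _ _; rewrite dE normrN normrM ler_piMr// normr_sin_le1.
have I0 w : 0 <= `|W w| by [].
have IW : P.-integrable setT (EFin \o (fun w => `|W w|)) by exact: rintegrable_norm.
have D1 := derivable_under_integral measurableT tI I1 I2 I0 IW I3.
have D2 := differentiation_under_integral measurableT tI I1 I2 I0 IW I3.
apply: DeriveDef => //; rewrite -derive1E D2 -mulN1r -RintegralZl//.
  by apply: eq_Rintegral => w _; rewrite dE mulN1r.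
apply: (@rintegrable_le _ _ _ P setT _ _ _ _ _ IW) => //.
  apply: measurable_funM => //.
  exact: (measurableT_comp (@measurable_sin R) (mVW t)).
by move=> w _; rewrite normrM ler_piMr// normr_sin_le1.
Qed.

End DifferentiateCos.

Section Characteristic.
Context d (T : measurableType d) (R : realType).
Variables (P : probability T R).

(** A sine is a cosine delayed by pi / 2, and the delay is absorbed in V. *)
Lemma is_derive_expectation_sin (V W : T -> R) (t : R) :
  measurable_fun setT V -> rintegrable P setT W ->
  is_derive t 1 (fun t => \int[P]_w sin (V w + t * W w))
    (\int[P]_w (W w * cos (V w + t * W w))).
Proof.
move=> mV iW.
have mV' : measurable_fun setT (fun w => V w - pi / 2) by exact: measurable_funB.
have sE a b : sin (a + b) = cos (a - pi / 2 + b) :> R.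
  by rewrite addrAC cosB cos_pihalf sin_pihalf mulr0 mulr1 add0r.
have cE a b : cos (a + b) = - sin (a - pi / 2 + b) :> R.
  by rewrite addrAC sinB cos_pihalf sin_pihalf mulr0 mulr1 sub0r opprK.
have mW : measurable_fun setT W by exact: rintegrable_measurable iW.
rewrite (_ : (fun t => _) = fun t => \int[P]_w cos (V w - pi / 2 + t * W w)); last first.
  by apply/funext => s; apply: eq_Rintegral => w _; exact: sE.
rewrite (_ : Rintegral _ _ _ = - \int[P]_w (W w * sin (V w - pi / 2 + t * W w))).
  exact: is_derive_expectation_cos.
rewrite -mulN1r -RintegralZl//.
  by apply: eq_Rintegral => w _; rewrite cE mulN1r mulrN.
apply: (@rintegrable_le _ _ _ P setT _ _ _ _ _ (rintegrable_norm _ iW)) => //.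
  apply: measurable_funM => //; apply: (measurableT_comp (@measurable_sin R)).
  by apply: measurable_funD => //; exact: measurable_funM.
by move=> w _; rewrite normrM ler_piMr// normr_sin_le1.
Qed.

(** The product with the integrating factor exp (v t^2 / 2) has zero derivative. *)
Lemma gaussian_ode (phi : R -> R) (v : R) :
  (forall t : R, is_derive t 1 phi (- (v * t * phi t))) ->
  forall t, phi t = phi 0 * expR (- (v * t ^+ 2 / 2)).
Proof.
move=> dphi t; pose psi s := phi s * expR (v * s ^+ 2 / 2).
have dpsi (s : R) : is_derive s 1 psi 0.
  by apply: is_derive_eq; rewrite /GRing.scale/=; field.
have : psi t = psi 0 by exact: is_derive_0_is_cst.
rewrite /psi expr0n/= mulr0 mul0r expR0 mulr1 => <-.
by rewrite -mulrA -expRD subrr expR0 mulr1.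
Qed.

(** Differentiating under the expectation, the hypotheses say that the real and imaginary parts of
    the characteristic function both solve phi' = - v t phi, with initial values 1 and 0. This
    serves both for the normal law and for the law of a step integral. *)
Lemma gaussian_charfun (W : T -> R) (v : R) : rintegrable P setT W ->
  (forall t, \int[P]_w (W w * sin (t * W w)) = v * t * \int[P]_w cos (t * W w)) ->
  (forall t, \int[P]_w (W w * cos (t * W w)) =
     - (v * t * \int[P]_w sin (t * W w))) ->
  forall t, \int[P]_w cos (t * W w) = expR (- (v * t ^+ 2 / 2)) /\
            \int[P]_w sin (t * W w) = 0.
Proof.
move=> iW Hs Hc t.
pose phi s := \int[P]_w cos (s * W w); pose psi s := \int[P]_w sin (s * W w).
have dphi (s : R) : is_derive s 1 phi (- (v * s * phi s)).
  rewrite -Hs; have := @is_derive_expectation_cos _ _ _ P (cst 0) W _ iW s.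
  under [X in is_derive _ _ X _]eq_fun do under eq_Rintegral do rewrite add0r.
  by under eq_Rintegral do rewrite add0r; apply.
have dpsi (s : R) : is_derive s 1 psi (- (v * s * psi s)).
  rewrite -Hc; have := @is_derive_expectation_sin (cst 0) W s _ iW.
  under [X in is_derive _ _ X _]eq_fun do under eq_Rintegral do rewrite add0r.
  by under eq_Rintegral do rewrite add0r; apply.
have phi0 : phi 0 = 1.
  rewrite /phi; under eq_Rintegral do rewrite mul0r cos0.
  exact: Rintegral_probability_cst.
have psi0 : psi 0 = 0.
  rewrite /psi; under eq_Rintegral do rewrite mul0r sin0.
  by rewrite Rintegral_cst// mul0r.
split; first by rewrite -/(phi t) (gaussian_ode dphi) phi0 mul1r.
by rewrite -/(psi t) (gaussian_ode dpsi) psi0 mul0r.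
Qed.

End Characteristic.

Lemma normal_pdf_fun (R : realType) (m s x : R) : s != 0 ->
  normal_pdf m s x = normal_peak s * normal_fun m s x.
Proof. by move=> s0; rewrite normal_pdfE. Qed.

(** * Integrals and moments of the normal law *)

Section NormalLaw.
Variable R : realType.
Notation mu := (@lebesgue_measure R).
Variable s : R.
Hypothesis s0 : s != 0.
Notation N := (@normal_prob R 0 s).
Notation pdf := (@normal_pdf R 0 s).

Lemma exprn_le_expR (y : R) m : 0 <= y -> y ^+ m <= m%:R ^+ m * expR y.
Proof.
move=> y0; case: m => [|m]; first by rewrite !expr0 mul1r -expR0 ler_expR.
have m0 : 0 < m.+1%:R :> R by rewrite ltr0n.
have ym : y / m.+1%:R <= expR (y / m.+1%:R).
  by rewrite (le_trans _ (expR_ge1Dx _))// lerDr.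
have := lerXn2r m.+1 _ _ ym; rewrite !nnegrE divr_ge0 ?expR_ge0// => /(_ isT isT).
rewrite -expRM_natl [_ * (y / _)]mulrC divfK ?gt_eqF// expr_div_n.
by rewrite ler_pdivrMr ?exprn_gt0// mulrC.
Qed.

(** Doubling the standard deviation absorbs any power of x: with y = x^2 / (8 s^2) the two
    exponentials are exp (-4 y) and exp (-y), and y^m <= m^m exp y. *)
Lemma even_moment_normal_fun_le m : exists2 K, 0 <= K &
  forall x, x ^+ m.*2 * normal_fun 0 s x <= K * normal_fun 0 (2 * s) x.
Proof.
have s2 : 0 < s ^+ 2 by rewrite exprn_even_gt0.
exists ((8 * s ^+ 2) ^+ m * m%:R ^+ m).
  by rewrite mulr_ge0 ?exprn_ge0 ?ler0n// mulr_ge0// ltW.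
move=> x; pose y := x ^+ 2 / (8 * s ^+ 2).
have y0 : 0 <= y by rewrite divr_ge0 ?sqr_ge0// mulr_ge0// ltW.
have -> : normal_fun 0 s x = expR (- (4 * y)).
  by rewrite /normal_fun/= subr0 /y; congr expR; field.
have -> : normal_fun 0 (2 * s) x = expR (- y).
  by rewrite /normal_fun/= subr0 /y; congr expR; field.
have -> : x ^+ m.*2 = (8 * s ^+ 2) ^+ m * y ^+ m.
  rewrite -exprMn -mul2n exprM; congr (_ ^+ _); rewrite /y; field.
  exact: s0.
have c0 : 0 <= (8 * s ^+ 2) ^+ m by rewrite exprn_ge0// mulr_ge0// ltW.
rewrite -mulrA -[leRHS]mulrA ler_wpM2l//.
rewrite (le_trans (ler_wpM2r (expR_ge0 _) (exprn_le_expR m y0)))//.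
by rewrite -mulrA ler_wpM2l ?exprn_ge0// -expRD ler_expR; lra.
Qed.



Lemma rintegrable_moment_pdf m :
  rintegrable mu setT (fun x => `|x| ^+ m * pdf x).
Proof.
have s20 : 2 * s != 0 by rewrite mulf_neq0 ?pnatr_eq0.
(* Since |x|^m <= x^(2m) + 1, the bounds for the exponents 2m and 0 control every absolute
   moment. *)
have [K K0 HK] := even_moment_normal_fun_le m.
have [K1 K10 HK1] := even_moment_normal_fun_le 0.
have P0 := normal_peak_gt0 s0; have P20 := normal_peak_gt0 s20.
have I2 : rintegrable mu setT (fun x =>
    normal_peak s * (K + K1) / normal_peak (2 * s) * normal_pdf 0 (2 * s) x).
  by apply: rintegrableZ => //; exact: integrable_normal_pdf.
apply: (rintegrable_le measurableT _ _ I2).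
  apply: measurable_funM; last exact: measurable_normal_pdf.
  by apply: measurable_funX; exact: normr_measurable.
move=> x _; rewrite ger0_norm ?mulr_ge0 ?exprn_ge0 ?normal_pdf_ge0//.
rewrite !normal_pdf_fun// mulrCA.
rewrite [leRHS](_ : _ = normal_peak s * ((K + K1) * normal_fun 0 (2 * s) x)); last first.
  by field; rewrite gt_eqF.
rewrite ler_wpM2l ?(ltW P0)// mulrDl.
apply: (le_trans _ (lerD (HK x) (HK1 x))).
rewrite expr0 -mulrDl ler_wpM2r ?normal_fun_ge0//.
have [x1|x1] := lerP `|x| 1.
  apply: (@le_trans _ _ 1); first exact: exprn_ile1.
  by rewrite lerDr -mul2n exprM exprn_ge0 ?sqr_ge0.
rewrite -[x ^+ _]ger0_norm; last by rewrite -mul2n exprM exprn_ge0 ?sqr_ge0.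
rewrite normrX -addnn exprD (@le_trans _ _ (`|x| ^+ m * `|x| ^+ m)) ?lerDl//.
by rewrite ler_peMr ?exprn_ge0// exprn_ege1// ltW.
Qed.

(** The Radon-Nikodym derivative of the normal law has the same integral as the density over every
    measurable set, hence agrees with it almost everywhere. *)
Lemma ge0_integral_normal (f : measurableTypeR R -> \bar R) :
  measurable_fun setT f -> (forall x, 0 <= f x)%E ->
  (\int[N]_x f x = \int[mu]_x (f x * (pdf x)%:E))%E.
Proof.
move=> mf f0; have dom := normal_prob_dominates 0 s.
rewrite -(Radon_Nikodym_SigmaFinite.change_of_variables dom)//.
have ih := Radon_Nikodym_SigmaFinite.f_integrable dom.
have mp : measurable_fun setT (EFin \o pdf).
  by apply/measurable_EFinP; exact: measurable_normal_pdf.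
apply: ae_eq_integral => //.
- by apply: emeasurable_funM => //; exact: measurable_int ih.
- exact: emeasurable_funM.
- apply: ae_eqe_mul2l; apply: integral_ae_eq => //= E _ mE.
  by rewrite -Radon_Nikodym_SigmaFinite.f_integral.
Qed.

Lemma rintegrable_normal (g : measurableTypeR R -> R) : measurable_fun setT g ->
  rintegrable mu setT (fun x => g x * pdf x) -> rintegrable N setT g.
Proof.
move=> mg /integrableP[_ fin]; apply/integrableP; split.
  exact/measurable_EFinP.
apply: le_lt_trans fin; rewrite ge0_integral_normal//; last first.
  by apply: measurableT_comp => //; exact/measurable_EFinP.
rewrite le_eqVlt; apply/orP; left; apply/eqP; apply: eq_integral => x _.
by rewrite /= normrM [X in (_ * X)%:E]ger0_norm ?normal_pdf_ge0.
Qed.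

(** The density is nonnegative, so multiplying by it commutes with taking positive and negative
    parts, and each part falls under [ge0_integral_normal]. *)
Lemma Rintegral_normal (g : measurableTypeR R -> R) : measurable_fun setT g ->
  \int[N]_x g x = \int[mu]_x (g x * pdf x).
Proof.
move=> mg; rewrite /Rintegral; congr fine.
have mG : measurable_fun setT (EFin \o g) by exact/measurable_EFinP.
have p0 x : (0 <= (pdf x)%:E)%E by rewrite lee_fin normal_pdf_ge0.
rewrite [LHS]integralE [RHS]integralE.
have E : (fun x => (g x * pdf x)%:E) = (fun x => (pdf x)%:E * (EFin \o g) x)%E.
  by apply/funext => x; rewrite /= -EFinM mulrC.
rewrite E; pose h x := ((pdf x)%:E * (EFin \o g) x)%E; rewrite -/h.
have -> : h^\+%E = fun x => ((pdf x)%:E * (EFin \o g)^\+ x)%E.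
  by apply/funext => x; rewrite !funeposE (maxe_pMr _ _ _ (p0 x))// mule0.
have -> : h^\-%E = fun x => ((pdf x)%:E * (EFin \o g)^\- x)%E.
  by apply/funext => x; rewrite !funenegE -muleN (maxe_pMr _ _ _ (p0 x))// mule0.
congr (_ - _)%E.
  rewrite ge0_integral_normal//; last exact: measurable_funepos.
  by apply: eq_integral => x _; rewrite muleC.
rewrite ge0_integral_normal//; last exact: measurable_funeneg.
by apply: eq_integral => x _; rewrite muleC.
Qed.

End NormalLaw.

(** * Integration by parts against the normal density *)

Section NormalStein.
Variable R : realType.
Notation mu := (@lebesgue_measure R).
Variable s : R.
Hypothesis s0 : s != 0.
Notation N := (@normal_prob R 0 s).
Notation pdf := (@normal_pdf R 0 s).

Lemma is_derive_normal_pdf (x : R) : is_derive x 1 pdf (- (x / s ^+ 2 * pdf x)).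
Proof.
rewrite (_ : pdf = fun x => normal_peak s * expR (- (x ^+ 2 * (s ^+ 2 *+ 2)^-1))); last first.
  by apply/funext => y; rewrite normal_pdf_fun// /normal_fun subr0 mulNr.
by apply: is_derive_eq; rewrite /GRing.scale/=; field.
Qed.

Variables (f f' : R -> R) (C : R).
Hypothesis df : forall x : R, is_derive x 1 f (f' x).
Hypothesis cf' : continuous f'.
Hypothesis fC : forall x, `|f x| <= C * (1 + `|x|).
Hypothesis f'C : forall x, `|f' x| <= C.

Let C0 : 0 <= C. Proof. exact: le_trans (f'C 0). Qed.

Let mf : measurable_fun setT f.
Proof.
apply: continuous_measurable_fun => x.
by apply: differentiable_continuous; apply/derivable1_diffP; case: (df x).
Qed.

Let pdf0 x : 0 <= pdf x. Proof. exact: normal_pdf_ge0. Qed.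

Let mpdf : measurable_fun setT pdf. Proof. exact: measurable_normal_pdf. Qed.

Let I1 : rintegrable mu setT (fun x => f' x * pdf x).
Proof.
apply: (rintegrable_le measurableT _ _
  (rintegrableZ measurableT C (rintegrable_moment_pdf s0 0))).
  by apply: measurable_funM => //; exact: continuous_measurable_fun.
by move=> x _; rewrite expr0 mul1r normrM (ger0_norm (pdf0 x)) ler_wpM2r.
Qed.

Let I2 : rintegrable mu setT (fun x => x * f x * pdf x).
Proof.
apply: (rintegrable_le measurableT _ _
  (rintegrableZ measurableT C (rintegrableD measurableT
    (rintegrable_moment_pdf s0 1) (rintegrable_moment_pdf s0 2)))).
  by apply: measurable_funM => //; exact: measurable_funM.
move=> x _; rewrite !normrM (ger0_norm (pdf0 x)) -mulrDl mulrA ler_wpM2r//.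
rewrite [leRHS](_ : _ = `|x| * (C * (1 + `|x|))); last by ring.
by rewrite ler_wpM2l.
Qed.

Let F x := f x * pdf x.
Let G x := f' x * pdf x - s ^- 2 * (x * f x * pdf x).

Let dF (x : R) : is_derive x 1 F (G x).
Proof.
have dp := is_derive_normal_pdf x; apply: is_derive_eq.
by rewrite /GRing.scale/= /G; field.
Qed.

Let cF : continuous F.
Proof.
move=> x; apply: differentiable_continuous; apply/derivable1_diffP.
by case: (dF x).
Qed.

Let cG : continuous G.
Proof.
have cf : continuous f.
  by move=> x; apply: differentiable_continuous; apply/derivable1_diffP; case: (df x).
have cp := @continuous_normal_pdf R 0 s s0.
move=> x; apply: cvgB; first by apply: cvgM; [exact: cf'|exact: cp].
apply: cvgMr; apply: cvgM; last exact: cp.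
by apply: cvgM; [exact: cvg_id|exact: cf].
Qed.

(** For |x| >= 1 the growth 1 + |x| is at most 2 |x|; spending the bound on x^2 times the density
    then leaves a decay of order 1 / |x|. *)
Let boundary_le (x : R) K : (forall x, x ^+ 2 * pdf x <= K) -> 1 <= `|x| ->
  `|F x| <= 2 * C * K / `|x|.
Proof.
move=> HK x1; have x0 : 0 < `|x| by exact: lt_le_trans x1.
rewrite normrM (ger0_norm (pdf0 x)) ler_pdivlMr//.
apply: (@le_trans _ _ (C * (1 + `|x|) * pdf x * `|x|)).
  by rewrite ler_wpM2r// ler_wpM2r.
apply: (@le_trans _ _ (C * (2 * `|x|) * pdf x * `|x|)).
  by do 2![rewrite ler_wpM2r//]; rewrite ler_wpM2l//; lra.
rewrite [leLHS](_ : _ = 2 * C * (`|x| ^+ 2 * pdf x)); last by ring.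
by rewrite real_normK ?num_real// ler_wpM2l// mulr_ge0.
Qed.

Let boundary_cvg : F n.+1%:R - F (- n.+1%:R) @[n --> \oo] --> 0.
Proof.
have [K K0 HK] := even_moment_normal_fun_le s0 1.
have HK' x : x ^+ 2 * pdf x <= normal_peak s * K.
  rewrite normal_pdf_fun// mulrCA ler_wpM2l ?normal_peak_ge0//.
  rewrite (le_trans (HK x))// ler_piMr// /normal_fun -expR0 ler_expR mulNr oppr_le0.
  by rewrite mulr_ge0 ?sqr_ge0// invr_ge0 mulrn_wge0// sqr_ge0.
apply: norm_cvg0; apply: (@squeeze_cvgr _ _ _ _ (cst 0)
  (fun n => 4 * C * (normal_peak s * K) * n.+1%:R^-1)).
- apply: nearW => n; rewrite normr_ge0/=.
  have n1 : 1 <= n.+1%:R :> R by rewrite ler1n.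
  rewrite (le_trans (ler_normB _ _))//.
  have /= b1 := boundary_le (x := n.+1%:R) HK'.
  have /= b2 := boundary_le (x := - n.+1%:R) HK'.
  rewrite normrN normr_nat in b1 b2.
  rewrite (le_trans (lerD (b1 n1) (b2 n1)))// le_eqVlt; apply/orP; left.
  by apply/eqP; ring.
- exact: cvg_cst.
- rewrite -[X in _ --> X](mulr0 (4 * C * (normal_peak s * K))).
  by apply: cvgMr; exact: cvg_harmonic.
Qed.

(** G is the derivative of F = f * pdf, and its integral over the line is 0: over [- (n + 1), n + 1]
    it is a boundary term that tends to 0, and the truncated integrals converge by domination by
    |G|. *)
Lemma normal_stein :
  \int[mu]_x (x * f x * pdf x) = s ^+ 2 * \int[mu]_x (f' x * pdf x).
Proof.
have I2' := rintegrableZ measurableT (- s ^- 2) I2.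
have IG : rintegrable mu setT G.
  rewrite (_ : G = fun x => f' x * pdf x + - s ^- 2 * (x * f x * pdf x)).
    exact: (rintegrableD measurableT I1 I2').
  by apply/funext => x; rewrite mulNr.
have E n : \int[mu]_(x in `[- n.+1%:R, n.+1%:R]) G x = F n.+1%:R - F (- n.+1%:R).
  have n0 : 0 < n.+1%:R :> R by rewrite ltr0n.
  rewrite /Rintegral (@continuous_FTC2 _ G F) ?gtrN//.
  - exact: continuous_subspaceT.
  - split; first by move=> x _; case: (dF x).
      exact/cvg_at_right_filter/cF.
    exact/cvg_at_left_filter/cF.
  - by move=> x _; rewrite derive1E; exact: derive_val.
have [||||_ cv] := @rdominated_cvg _ _ _ mu setT measurableT
  (fun n => G \_ `[- n.+1%:R, n.+1%:R]) G (fun x => `|G x|).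
- move=> n; apply/measurable_restrict => //; rewrite setTI.
  by apply: measurable_funTS; exact: rintegrable_measurable IG.
- move=> x _; apply: cvg_near_cst; near=> n.
  rewrite patchE ifT// inE/= in_itv/= -ler_norml.
  rewrite (@le_trans _ _ n%:R) ?ler_nat//; near: n; exact: nbhs_infty_ger.
- by move=> n x _; rewrite patchE; case: ifPn => // _; rewrite normr0.
- exact: rintegrable_norm.
have {}cv : F n.+1%:R - F (- n.+1%:R) @[n --> \oo] --> \int[mu]_x G x.
  by under eq_cvg do rewrite -E Rintegral_mkcond.
have G0 := cvg_unique _ cv boundary_cvg.
move: (G0 (@Rhausdorff _)) => {}G0.
rewrite (_ : G = fun x => f' x * pdf x + - s ^- 2 * (x * f x * pdf x)) in G0; last first.
  by apply/funext => x; rewrite mulNr.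
rewrite RintegralD// RintegralZl// in G0.
apply: (@mulfI _ (s ^- 2)); first by rewrite invr_eq0 expf_neq0.
by rewrite mulKf ?expf_neq0//; apply/eqP; rewrite -subr_eq0 -oppr_eq0 opprB -mulNr G0.
Unshelve. all: by end_near. Qed.

End NormalStein.

(** * Moments and characteristic function of a centered Gaussian variable *)

Section CenteredGaussian.
Variable R : realType.
Notation mu := (@lebesgue_measure R).

Section Normal.
Variable s : R.
Hypothesis s0 : s != 0.
Notation N := (@normal_prob R 0 s).

Lemma rintegrable_normal_moment m :
  rintegrable N setT (fun x : measurableTypeR R => `|x| ^+ m).
Proof.
apply: rintegrable_normal; last exact: rintegrable_moment_pdf.
by apply: measurable_funX; exact: normr_measurable.
Qed.

Lemma rintegrable_normal_id : rintegrable N setT (fun x : measurableTypeR R => x).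
Proof.
apply: (rintegrable_le measurableT _ _ (rintegrable_normal_moment 1)) => //.
Qed.

(** Stein's identity for the identity function reduces the second moment to the total mass of the
    density. *)
Lemma normal_second_moment : \int[N]_x x ^+ 2 = s ^+ 2.
Proof.
have m2 : measurable_fun setT (fun x : R => x ^+ 2) by exact: measurable_funX.
rewrite Rintegral_normal//.
rewrite (@eq_Rintegral _ _ _ mu setT (fun x : R => x * x * normal_pdf 0 s x))//.
rewrite (@normal_stein _ _ s0 id (cst 1) 1)//.
- under eq_Rintegral do rewrite mul1r.
  by rewrite /Rintegral integral_normal_pdf mulr1.

- by move=> x; exact: cvg_cst.
- by move=> x; rewrite mul1r lerDr.
- by move=> x; rewrite normr1.

Qed.

(** Stein's identity for sin (u x) and cos (u x) gives the two hypotheses of [gaussian_charfun] with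
    v = s^2. The constant 1 + |u| bounds both these functions and their derivatives. *)
Lemma normal_charfun t :
  \int[N]_x cos (t * x) = expR (- (s ^+ 2 * t ^+ 2 / 2)) /\
  \int[N]_x sin (t * x) = 0.
Proof.
have mt u : measurable_fun setT (fun x : R => u * x) by exact: measurable_funM.
have mc u : measurable_fun setT (fun x : R => cos (u * x)).
  exact: (measurableT_comp (@measurable_cos R)).
have ms u : measurable_fun setT (fun x : R => sin (u * x)).
  exact: (measurableT_comp (@measurable_sin R)).
have contM u : continuous (fun x : R => u * x).
  by move=> x; apply: cvgMr; exact: cvg_id.
have mxc u : measurable_fun setT (fun x : R => x * cos (u * x)).
  exact: measurable_funM.
have mxs u : measurable_fun setT (fun x : R => x * sin (u * x)).
  exact: measurable_funM.
have c1 := @normr_cos_le1 R.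
have s1 := @normr_sin_le1 R.
have le1C (u x : R) : 1 <= (1 + `|u|) * (1 + `|x|) :> R.
  by rewrite (@le_trans _ _ (1 + `|u|)) ?lerDl// ler_peMr ?lerDl ?addr_ge0.
have Ipdf (h : R -> R) : measurable_fun setT h -> (forall x, `|h x| <= 1) ->
    rintegrable mu setT (fun x => h x * normal_pdf 0 s x).
  move=> mh h1; apply: (rintegrable_le measurableT _ _ (@integrable_normal_pdf R 0 s)).
    by apply: measurable_funM => //; exact: measurable_normal_pdf.
  by move=> x _; rewrite normrM (ger0_norm (normal_pdf_ge0 _ _ _)) ler_piMl ?normal_pdf_ge0.
have dsin (u x : R) : is_derive x 1 (fun x => sin (u * x)) (u * cos (u * x)).
  by apply: is_derive_eq; rewrite /GRing.scale/=; ring.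
have dcos (u x : R) : is_derive x 1 (fun x => cos (u * x)) (- u * sin (u * x)).
  by apply: is_derive_eq; rewrite /GRing.scale/=; ring.
apply: (gaussian_charfun (P := N) (W := fun x : measurableTypeR R => x)).
- exact: rintegrable_normal_id.
- move=> u; rewrite (Rintegral_normal _ (mxs u)) (Rintegral_normal _ (mc u)).
  rewrite (@normal_stein _ _ s0 _ _ (1 + `|u|) (dsin u)).
  - rewrite -mulrA; congr (_ * _); rewrite -RintegralZl//; last exact: Ipdf.
    by apply: eq_Rintegral => x _; rewrite mulrA.
  - by move=> x; apply: cvgMr; apply: (cvg_comp _ cos (contM u x)); exact: continuous_cos.
  - by move=> x; exact: le_trans (le1C u x).
  - by move=> x; rewrite normrM (@le_trans _ _ `|u|) ?lerDr// ler_piMr.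
- move=> u; rewrite (Rintegral_normal _ (mxc u)) (Rintegral_normal _ (ms u)).
  rewrite (@normal_stein _ _ s0 _ _ (1 + `|u|) (dcos u)).
  - rewrite -mulrA -mulrN -mulNr; congr (_ * _); rewrite -RintegralZl//; last exact: Ipdf.
    by apply: eq_Rintegral => x _; rewrite mulrA.
  - by move=> x; apply: cvgMr; apply: (cvg_comp _ sin (contM u x)); exact: continuous_sin.
  - by move=> x; exact: le_trans (le1C u x).
  - by move=> x; rewrite normrM normrN (@le_trans _ _ `|u|) ?lerDr// ler_piMr.
Qed.

End Normal.

Context d (T : measurableType d) (P : probability T R).

Lemma Rintegral_dirac (g : measurableTypeR R -> R) (a : measurableTypeR R) :
  measurable_fun setT g -> rintegrable (\d_a) setT g /\ \int[\d_a]_x g x = g a.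
Proof.
move=> mg; have mG : measurable_fun setT (EFin \o g) by exact/measurable_EFinP.
split; last by rewrite /Rintegral integral_dirac// diracT mul1e.
apply/integrableP; split=> //.
rewrite integral_dirac//; first by rewrite diracT mul1e ltry.
exact: measurableT_comp.
Qed.

Let dirac0 : {measure set (measurableTypeR R) -> \bar R} := \d_(0 : measurableTypeR R).

Lemma centered_gaussian_moment (Y : T -> R) m : centered_gaussian_rv P Y ->
  rintegrable P setT (fun w => `|Y w| ^+ m).
Proof.
have mm : measurable_fun setT (fun x : R => `|x| ^+ m).
  by apply: measurable_funX; exact: normr_measurable.
move=> [mY [law|[s s0 law]]].
  exact: (rintegrable_law (nu := dirac0) mY law mm (Rintegral_dirac 0 mm).1).
have s1 : s != 0 by rewrite gt_eqF.
exact: (rintegrable_law mY law mm (rintegrable_normal_moment s1 m)).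
Qed.

(** Writing the variance as a second moment merges the Dirac and normal cases into one formula, and
    for linear combinations it makes the exponent quadratic in the coefficients. *)
Lemma centered_gaussian_charfun (Y : T -> R) : centered_gaussian_rv P Y ->
  \int[P]_w cos (Y w) = expR (- (\int[P]_w Y w ^+ 2 / 2)) /\
  \int[P]_w sin (Y w) = 0.
Proof.
have mc := @measurable_cos R; have ms := @measurable_sin R.
have m2 : measurable_fun setT (fun x : R => x ^+ 2) by exact: measurable_funX.
move=> [mY [law|[s s0 law]]].
  rewrite (Rintegral_law (nu := dirac0) mY law mc (Rintegral_dirac 0 mc).1).
  rewrite (Rintegral_law (nu := dirac0) mY law ms (Rintegral_dirac 0 ms).1).
  rewrite (Rintegral_law (nu := dirac0) mY law m2 (Rintegral_dirac 0 m2).1).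
  rewrite (Rintegral_dirac 0 mc).2 (Rintegral_dirac 0 ms).2 (Rintegral_dirac 0 m2).2.
  by rewrite expr0n/= mul0r oppr0 expR0 cos0 sin0.
have {}s0 : s != 0 by rewrite gt_eqF.
rewrite (Rintegral_law mY law mc); last first.
  by apply: (@rintegrable_bounded _ _ _ _ _ 1) => // x; rewrite normr_cos_le1.
rewrite (Rintegral_law mY law ms); last first.
  by apply: (@rintegrable_bounded _ _ _ _ _ 1) => // x; rewrite normr_sin_le1.
rewrite (Rintegral_law mY law m2); last first.
  apply: (rintegrable_le measurableT _ _ (rintegrable_normal_moment s0 2)) => //.
  by move=> x _; rewrite normrX.
have := normal_charfun s0 1; under eq_Rintegral do rewrite mul1r.
under [X in _ /\ X = _]eq_Rintegral do rewrite mul1r.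
by rewrite normal_second_moment// expr1n mulr1.
Qed.

End CenteredGaussian.

(** * Stein's identity for Gaussian vectors *)

Section AllMoments.
Context d (T : measurableType d) (R : realType) (P : probability T R).
Implicit Types U V : T -> R.

(** These variables form an algebra, so that any polynomial in Gaussian variables is available as an
    integrable majorant. *)
Definition all_moments U := measurable_fun setT U /\
  forall p, rintegrable P setT (fun w => `|U w| ^+ p).

Lemma all_moments_rintegrable U : all_moments U -> rintegrable P setT U.
Proof.
move=> [mU /(_ 1%N) I1]; apply: (rintegrable_le measurableT mU _ I1) => w _.
by rewrite expr1.
Qed.

Lemma all_moments_cst r : all_moments (fun=> r).
Proof.
by split=> [|p]; [exact: measurable_cst|exact: finite_measure_integrable_cst].
Qed.

Lemma all_moments_norm U : all_moments U -> all_moments (fun w => `|U w|).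
Proof.
move=> [mU IU]; split=> [|p]; first exact: measurableT_comp.
by under eq_fun do rewrite normr_id; exact: IU.
Qed.

Lemma all_momentsD U V : all_moments U -> all_moments V ->
  all_moments (fun w => U w + V w).
Proof.
move=> [mU IU] [mV IV]; split=> [|p]; first exact: measurable_funD.
apply: (rintegrable_le measurableT _ _
  (rintegrableZ measurableT (2 ^+ p) (rintegrableD measurableT (IU p) (IV p)))).
  by apply: measurable_funX; apply: measurableT_comp => //; exact: measurable_funD.
move=> w _; rewrite ger0_norm ?exprn_ge0//.
apply: (@le_trans _ _ ((2 * Num.max `|U w| `|V w|) ^+ p)).
  rewrite lerXn2r ?nnegrE ?mulr_ge0 ?le_max ?normr_ge0// (le_trans (ler_normD _ _))//.
  by rewrite mulr_natl mulr2n lerD// le_max lexx ?orbT.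
rewrite exprMn ler_wpM2l ?exprn_ge0//.
by have [_|_] := leP `|U w| `|V w|; rewrite ?lerDr ?lerDl exprn_ge0.
Qed.

Lemma all_momentsM U V : all_moments U -> all_moments V ->
  all_moments (fun w => U w * V w).
Proof.
move=> [mU IU] [mV IV]; split=> [|p]; first exact: measurable_funM.
apply: (rintegrable_le measurableT _ _
  (rintegrableD measurableT (IU (p + p)%N) (IV (p + p)%N))).
  by apply: measurable_funX; apply: measurableT_comp => //; exact: measurable_funM.
move=> w _; rewrite ger0_norm ?exprn_ge0// normrM exprMn !exprD.
have : 0 <= `|U w| ^+ p by rewrite exprn_ge0.
have : 0 <= `|V w| ^+ p by rewrite exprn_ge0.
by nra.
Qed.

Lemma all_momentsX U m : all_moments U -> all_moments (fun w => U w ^+ m).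
Proof.
move=> IU; elim: m => [|m IHm].
  by under eq_fun do rewrite expr0; exact: all_moments_cst.
by under eq_fun do rewrite exprS; exact: all_momentsM.
Qed.

Lemma all_moments_sum (I : Type) (s : seq I) (h : I -> T -> R) :
  (forall i, all_moments (h i)) -> all_moments (fun w => \sum_(i <- s) h i w).
Proof.
move=> Ih; elim: s => [|i s IHs].
  by under eq_fun do rewrite big_nil; exact: all_moments_cst.
by under eq_fun do rewrite big_cons; exact: all_momentsD.
Qed.

End AllMoments.

(** * Stein pairs and their closure properties *)

Section SteinPair.
Context d (T : measurableType d) (R : realType) (P : probability T R).
Variables (n : nat) (Y : T -> R) (c : 'I_n -> R) (Z : 'I_n -> T -> R).
Implicit Types (F : T -> R) (G : 'I_n -> T -> R).

(** G l stands for the derivative of F along Z l. Nothing ties G to F in the definition, which makes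
    the set of pairs linear and closed under dominated limits of both components. *)
Definition stein F G :=
  [/\ rintegrable P setT (fun w => Y w * F w),
      forall l, rintegrable P setT (G l) &
      \int[P]_w (Y w * F w) = \sum_l c l * \int[P]_w G l w].

Lemma stein_lin a b F G F' G' : stein F G -> stein F' G' ->
  stein (fun w => a * F w + b * F' w) (fun l w => a * G l w + b * G' l w).
Proof.
move=> [IF IG E] [IF' IG' E'].
have YE : (fun w => Y w * (a * F w + b * F' w)) =
    fun w => a * (Y w * F w) + b * (Y w * F' w).
  by apply/funext => w; ring.
split.
- by rewrite YE; apply: rintegrableD => //; exact: rintegrableZ.
- by move=> l; apply: rintegrableD => //; exact: rintegrableZ.
- rewrite YE RintegralD//; [|exact: rintegrableZ|exact: rintegrableZ].
  rewrite !RintegralZl// E E' !mulr_sumr -big_split; apply: eq_bigr => l _ /=.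
  rewrite RintegralD//; [|exact: rintegrableZ|exact: rintegrableZ].
  by rewrite !RintegralZl//; [ring|exact: IG'|exact: IG].
Qed.

Lemma stein_cvg (F_ : nat -> T -> R) (G_ : nat -> 'I_n -> T -> R) F G B B' :
  (forall m, stein (F_ m) (G_ m)) ->
  (forall w, F_ m w @[m --> \oo] --> F w) ->
  (forall l w, G_ m l w @[m --> \oo] --> G l w) ->
  (forall m w, `|F_ m w| <= B w) -> (forall m l w, `|G_ m l w| <= B' w) ->
  rintegrable P setT (fun w => `|Y w| * B w) -> rintegrable P setT B' ->
  stein F G.
Proof.
move=> S cF cG bF bG IB IB'.
have [||||IYF cvF] := @rdominated_cvg _ _ _ P setT measurableT
  (fun m w => Y w * F_ m w) (fun w => Y w * F w) (fun w => `|Y w| * B w).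
- by move=> m; have [/rintegrable_measurable] := S m.
- by move=> w _; apply: cvgMr; exact: cF.
- by move=> m w _; rewrite normrM ler_wpM2l.
- exact: IB.
have HG l : rintegrable P setT (G l) /\
    \int[P]_w G_ m l w @[m --> \oo] --> \int[P]_w G l w.
  apply: (rdominated_cvg measurableT _ (fun w _ => cG l w) (fun m w _ => bG m l w) IB').
  by move=> m; have [_ /(_ l)/rintegrable_measurable] := S m.
split=> //; first by move=> l; case: (HG l).
apply: (@cvg_unique _ (@Rhausdorff R) _ _ _ _ cvF).
rewrite (_ : (fun m => _) = fun m => \sum_l c l * \int[P]_w G_ m l w); last first.
  by apply/funext => m; have [_ _ ->] := S m.
apply: cvg_big => [|l _]; first exact: add_continuous.
by apply: cvgMr; case: (HG l).
Qed.

Hypothesis gYZ : forall (lam : 'I_n -> R) (eps : R),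
  centered_gaussian_rv P (fun w => \sum_l lam l * Z l w + eps * Y w).
Hypothesis covYZ : forall l, \int[P]_w (Y w * Z l w) = c l.

Lemma all_moments_gaussian_rv (W : T -> R) :
  centered_gaussian_rv P W -> all_moments P W.
Proof.
by move=> gW; split=> [|p]; [case: gW|exact: centered_gaussian_moment].
Qed.

Lemma all_moments_Y : all_moments P Y.
Proof.
apply: all_moments_gaussian_rv; have := gYZ (fun=> 0) 1.
congr (centered_gaussian_rv P); apply/funext => w.
by rewrite big1 ?add0r ?mul1r// => l _; rewrite mul0r.
Qed.

Lemma all_moments_Z l : all_moments P (Z l).
Proof.
apply: all_moments_gaussian_rv; have := gYZ (fun i => (i == l)%:R) 0.
congr (centered_gaussian_rv P); apply/funext => w.
rewrite mul0r addr0 (bigD1 l)//= eqxx mul1r big1 ?addr0// => i /negbTE->.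
by rewrite mul0r.
Qed.

Definition linZ (lam : 'I_n -> R) (w : T) := \sum_l lam l * Z l w.

Lemma all_moments_linZ lam : all_moments P (linZ lam).
Proof.
apply: all_moments_sum => l; apply: all_momentsM; last exact: all_moments_Z.
exact: all_moments_cst.
Qed.

Lemma cov_linZ lam : \int[P]_w (Y w * linZ lam w) = \sum_l lam l * c l.
Proof.
rewrite /linZ; under eq_Rintegral do rewrite mulr_sumr.
rewrite Rintegral_sum//; last first.
  move=> l _; apply: all_moments_rintegrable; apply: all_momentsM; first exact: all_moments_Y.
  by apply: all_momentsM; [exact: all_moments_cst|exact: all_moments_Z].
apply: eq_bigr => l _; rewrite -covYZ -RintegralZl//; last first.
  apply: all_moments_rintegrable.
  by apply: all_momentsM; [exact: all_moments_Y|exact: all_moments_Z].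
by apply: eq_Rintegral => w _; rewrite mulrCA.
Qed.

(** The coefficient of eps, twice the covariance of Y with [linZ lam], is all that remains after
    differentiation at eps = 0. *)
Lemma variance_linZ lam eps : \int[P]_w (linZ lam w + eps * Y w) ^+ 2 =
  \int[P]_w linZ lam w ^+ 2 + eps * (2 * \sum_l lam l * c l) +
  eps ^+ 2 * \int[P]_w Y w ^+ 2.
Proof.
have mW := all_moments_linZ lam; have mY := all_moments_Y.
have IW : rintegrable P setT (fun w => linZ lam w ^+ 2).
  exact/all_moments_rintegrable/all_momentsX.
have IY : rintegrable P setT (fun w => Y w ^+ 2).
  exact/all_moments_rintegrable/all_momentsX.
have IWY : rintegrable P setT (fun w => Y w * linZ lam w).
  exact/all_moments_rintegrable/all_momentsM.
rewrite -cov_linZ; transitivity (\int[P]_w (linZ lam w ^+ 2 +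
   eps * (2 * (Y w * linZ lam w)) + eps ^+ 2 * Y w ^+ 2)).
  by apply: eq_Rintegral => w _; ring.
have I2 := rintegrableZ measurableT 2 IWY.
have I3 := rintegrableZ measurableT eps I2.
have I4 := rintegrableZ measurableT (eps ^+ 2) IY.
rewrite RintegralD//; last exact: rintegrableD.
by rewrite RintegralD// !RintegralZl.
Qed.

Lemma rintegrable_bounded_mul F : measurable_fun setT F ->
  (forall w, `|F w| <= 1) -> rintegrable P setT (fun w => Y w * F w).
Proof.
move=> mF F1; have mY := all_moments_Y.
apply: (rintegrable_le measurableT _ _ (all_moments_rintegrable (all_moments_norm mY))).
  by apply: measurable_funM => //; case: mY.
by move=> w _; rewrite normrM ler_piMr.
Qed.

Lemma stein_trig lam :
  stein (fun w => cos (linZ lam w)) (fun l w => - lam l * sin (linZ lam w)) /\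
  stein (fun w => sin (linZ lam w)) (fun l w => lam l * cos (linZ lam w)).
Proof.
have [mW _] := all_moments_linZ lam; have [mY _] := all_moments_Y.
have IY := all_moments_rintegrable all_moments_Y.
have mcW := measurableT_comp (@measurable_cos R) mW.
have msW := measurableT_comp (@measurable_sin R) mW.
have c1 := @normr_cos_le1 R.
have s1 := @normr_sin_le1 R.
have Ic : rintegrable P setT (fun w => cos (linZ lam w)).
  exact: (@rintegrable_bounded _ _ _ P _ 1).
have Is : rintegrable P setT (fun w => sin (linZ lam w)).
  exact: (@rintegrable_bounded _ _ _ P _ 1).
pose B := \sum_l lam l * c l.
have Ecos eps := (centered_gaussian_charfun (gYZ lam eps)).1.
have Esin eps := (centered_gaussian_charfun (gYZ lam eps)).2.
have W0 : (fun w => linZ lam w + 0 * Y w) = linZ lam.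
  by apply/funext => w; rewrite mul0r addr0.
have EsW : \int[P]_w sin (linZ lam w) = 0.
  by rewrite -(Esin 0); apply: eq_Rintegral => w _; rewrite mul0r addr0.
split; split=> //.
- exact: rintegrable_bounded_mul.
- by move=> l; exact: rintegrableZ.
- transitivity (0 : R).
    (* The sine expectation is 0 for every eps; its derivative at 0 is E[Y cos], which therefore
       vanishes. *)
    have := @is_derive_expectation_sin _ _ _ P (linZ lam) Y 0 mW IY.
    rewrite (_ : (fun t => _) = cst 0); last by apply/funext => t; exact: Esin.
    move=> /@derive_val; rewrite derive_cst => ->.
    by apply: eq_Rintegral => w _; rewrite mul0r addr0.
  by rewrite big1// => l _; rewrite RintegralZl// EsW !mulr0.
- exact: rintegrable_bounded_mul.
- by move=> l; exact: rintegrableZ.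
- transitivity (B * \int[P]_w cos (linZ lam w)); last first.
    rewrite mulr_suml; apply: eq_bigr => l _.
    by rewrite RintegralZl//; ring.
  have := @is_derive_expectation_cos _ _ _ P (linZ lam) Y mW IY 0.
  pose A := \int[P]_w linZ lam w ^+ 2; pose C := \int[P]_w Y w ^+ 2.
  rewrite (_ : (fun t => _) = fun t => expR (- ((A + t * (2 * B) + t ^+ 2 * C) / 2))); last first.
    by apply/funext => t; rewrite Ecos variance_linZ.
  have dE : is_derive (0 : R) 1 (fun t => expR (- ((A + t * (2 * B) + t ^+ 2 * C) / 2)))
      (- (B * expR (- (A / 2)))).
    by apply: is_derive_eq; rewrite /GRing.scale/= !(mul0r, expr0n, addr0)/=; field.
  (* The same derivative computed twice: - E[Y sin] under the expectation, and - B exp (- A / 2)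
     from the closed form. *)
  move=> /@derive_val; rewrite derive_val => /oppr_inj E.
  transitivity (\int[P]_w (Y w * sin (linZ lam w + 0 * Y w))).
    by apply: eq_Rintegral => w _; rewrite mul0r addr0.
  rewrite -E; congr (_ * _).
  have := Ecos 0; rewrite variance_linZ mul0r expr0n/= mul0r !addr0 => <-.
  by apply: eq_Rintegral => w _; rewrite mul0r addr0.
Qed.

End SteinPair.

Definition upd (I : eqType) (A : Type) (x : I -> A) (k : I) (t : A) : I -> A :=
  fun i => if i == k then t else x i.

Lemma upd_same (I : eqType) (A : Type) (x : I -> A) k : upd x k (x k) = x.
Proof. by apply/funext => i; rewrite /upd; case: eqP => // ->. Qed.

Lemma upd_upd (I : eqType) (A : Type) (x : I -> A) k s t :
  upd (upd x k s) k t = upd x k t.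
Proof. by apply/funext => i; rewrite /upd; case: eqP. Qed.

Lemma updC (I : eqType) (A : Type) (x : I -> A) k l s t : k != l ->
  upd (upd x k s) l t = upd (upd x l t) k s.
Proof.
move=> kl; apply/funext => i; rewrite /upd.
by case: (eqVneq i l) => // ->; case: eqVneq kl => // ->; rewrite eqxx.
Qed.

(** * Trigonometric polynomials of a Gaussian vector *)

Section TrigonometricPairs.
Context d (T : measurableType d) (R : realType) (P : probability T R).
Variables (n : nat) (Y : T -> R) (c : 'I_n -> R) (Z : 'I_n -> T -> R).
Hypothesis gYZ : forall (lam : 'I_n -> R) (eps : R),
  centered_gaussian_rv P (fun w => \sum_l lam l * Z l w + eps * Y w).
Hypothesis covYZ : forall l, \int[P]_w (Y w * Z l w) = c l.
Implicit Types (F : T -> R) (G : 'I_n -> T -> R).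

Notation stein := (stein P Y c).

(* Pairs (trigonometric polynomial in [Z], its gradient). *)
Inductive trigpair : (T -> R) -> ('I_n -> T -> R) -> Prop :=
| trigpair_cos lam : trigpair (fun w => cos (linZ Z lam w))
    (fun l w => - lam l * sin (linZ Z lam w))
| trigpair_sin lam : trigpair (fun w => sin (linZ Z lam w))
    (fun l w => lam l * cos (linZ Z lam w))
| trigpair_lin a b F G F' G' : trigpair F G -> trigpair F' G' ->
    trigpair (fun w => a * F w + b * F' w) (fun l w => a * G l w + b * G' l w).

Lemma trigpair_stein F G : trigpair F G -> stein F G.
Proof.
elim=> [lam|lam|a b F1 G1 F2 G2 _ S1 _ S2].
- exact: (stein_trig gYZ covYZ lam).1.
- exact: (stein_trig gYZ covYZ lam).2.
- exact: stein_lin.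
Qed.

Lemma trigpair_bounded F G : trigpair F G ->
  exists2 M, 0 <= M & forall w, `|F w| <= M /\ forall l, `|G l w| <= M.
Proof.
have c1 := @normr_cos_le1 R.
have s1 := @normr_sin_le1 R.
have leS (lam : 'I_n -> R) l : `|lam l| <= 1 + \sum_i `|lam i|.
  by rewrite (bigD1 l)//= addrCA lerDl addr_ge0// sumr_ge0.
have ge1 (lam : 'I_n -> R) : 1 <= 1 + \sum_i `|lam i| by rewrite lerDl sumr_ge0.
elim=> [lam|lam|a b F1 G1 F2 G2 _ [M1 M10 H1] _ [M2 M20 H2]].
- exists (1 + \sum_l `|lam l|) => [|w]; first exact: le_trans (ge1 lam).
  split=> [|l]; first exact: le_trans (ge1 lam).
  by rewrite normrM normrN (le_trans _ (leS lam l))// ler_piMr.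
- exists (1 + \sum_l `|lam l|) => [|w]; first exact: le_trans (ge1 lam).
  split=> [|l]; first exact: le_trans (ge1 lam).
  by rewrite normrM (le_trans _ (leS lam l))// ler_piMr.
- exists (`|a| * M1 + `|b| * M2) => [|w]; first by rewrite addr_ge0 ?mulr_ge0.
  have [h1 k1] := H1 w; have [h2 k2] := H2 w.
  by split=> [|l]; rewrite (le_trans (ler_normD _ _))// !normrM lerD// ler_wpM2l.
Qed.

Lemma trigpair_eq F G F' G' : F =1 F' -> G =2 G' -> trigpair F G -> trigpair F' G'.
Proof.
move=> FF' GG'; suff [-> ->] : F = F' /\ G = G' by [].
by split; [exact/funext|apply/funext => l; apply/funext => w].
Qed.

Lemma linZ_upd lam k e w :
  linZ Z (upd lam k (lam k + e)) w = linZ Z lam w + e * Z k w.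
Proof.
rewrite /linZ (bigD1 k)//= [in RHS](bigD1 k)//= /upd eqxx mulrDl addrAC.
congr (_ + _ + _); apply: eq_bigr => i /negbTE->; by [].
Qed.

(** Product-to-sum formulas: the factor sin (a Z_k) moves the k-th frequency by a and by - a, so the
    product stays in the span. The second component is the product rule. *)
Lemma trigpair_mul_sin a k F G : trigpair F G ->
  trigpair (fun w => F w * sin (a * Z k w))
    (fun l w => G l w * sin (a * Z k w) + F w * (a * cos (a * Z k w) *+ (l == k))).
Proof.
elim=> [lam|lam|p q F1 G1 F2 G2 _ S1 _ S2].
- apply: trigpair_eq (trigpair_lin (2^-1) (- 2^-1)
    (trigpair_sin (upd lam k (lam k + a))) (trigpair_sin (upd lam k (lam k + - a)))) => [w|l w].
    by rewrite !linZ_upd !mulNr sinD sinB; field.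
  rewrite !linZ_upd !mulNr cosD cosB /upd; case: eqVneq => [->|_].
    by rewrite mulr1n; field.
  by rewrite mulr0n; field.
- apply: trigpair_eq (trigpair_lin (- 2^-1) (2^-1)
    (trigpair_cos (upd lam k (lam k + a))) (trigpair_cos (upd lam k (lam k + - a)))) => [w|l w].
    by rewrite !linZ_upd !mulNr cosD cosB; field.
  rewrite !linZ_upd !mulNr sinD sinB /upd; case: eqVneq => [->|_].
    by rewrite mulr1n; field.
  by rewrite mulr0n; field.
- by apply: trigpair_eq (trigpair_lin p q S1 S2) => [w|l w]; ring.
Qed.

(* Closing under multiplication by trigonometric polynomials in advance makes
   the class stable under products by [theta k]. *)
Definition mul_stein F G := forall Q Q', trigpair Q Q' ->
  stein (fun w => Q w * F w) (fun l w => Q' l w * F w + Q w * G l w).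

Lemma stein_eq F G F' G' : F =1 F' -> G =2 G' -> stein F G -> stein F' G'.
Proof.
move=> FF' GG'; suff [-> ->] : F = F' /\ G = G' by [].
by split; [exact/funext|apply/funext => l; apply/funext => w].
Qed.

Lemma mul_stein_stein F G : mul_stein F G -> stein F G.
Proof.
(* Frequency 0 gives the test factor Q = 1 with zero gradient. *)
move=> /(_ _ _ (trigpair_cos (fun=> 0))).
have linZ0 w : linZ Z (fun=> 0) w = 0 by rewrite /linZ big1// => l _; rewrite mul0r.
by apply: stein_eq => [w|l w]; rewrite linZ0 cos0 ?sin0; ring.
Qed.

Lemma mul_stein_lin a b F G F' G' : mul_stein F G -> mul_stein F' G' ->
  mul_stein (fun w => a * F w + b * F' w) (fun l w => a * G l w + b * G' l w).
Proof.
move=> S S' Q Q' tQ; apply: stein_eq (stein_lin a b (S _ _ tQ) (S' _ _ tQ)) => [w|l w].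
  by ring.
by ring.
Qed.

Lemma mul_stein_cst a : mul_stein (fun=> a) (fun _ _ => 0).
Proof.
move=> Q Q' tQ.
apply: stein_eq (stein_lin a 0 (trigpair_stein tQ) (trigpair_stein tQ)) => [w|l w].
  by ring.
by ring.
Qed.

Lemma mul_stein_cvg (F_ : nat -> T -> R) (G_ : nat -> 'I_n -> T -> R) F G M :
  (forall m, mul_stein (F_ m) (G_ m)) ->
  (forall w, F_ m w @[m --> \oo] --> F w) ->
  (forall l w, G_ m l w @[m --> \oo] --> G l w) ->
  (forall m w, `|F_ m w| <= M) -> (forall m l w, `|G_ m l w| <= M) ->
  mul_stein F G.
Proof.
move=> S cF cG bF bG Q Q' tQ; have [M' M'0 HM'] := trigpair_bounded tQ.
apply: (stein_cvg (F_ := fun m w => Q w * F_ m w)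
  (G_ := fun m l w => Q' l w * F_ m w + Q w * G_ m l w)
  (B := fun=> M' * M) (B' := fun=> M' * M + M' * M)).
- by move=> m; exact: S.
- by move=> w; apply: cvgMr; exact: cF.
- move=> l w; apply: cvgD; apply: cvgMr; first exact: cF.
  exact: cG.
- by move=> m w; rewrite normrM ler_pM//; case: (HM' w).
- move=> m l w; rewrite (le_trans (ler_normD _ _))// !normrM.
  by have [h1 h2] := HM' w; rewrite lerD// ler_pM.
- apply: all_moments_rintegrable; apply: all_momentsM; last exact: all_moments_cst.
  exact/all_moments_norm/(all_moments_Y gYZ).
- exact/all_moments_rintegrable/all_moments_cst.
Qed.

Variable a : R.
(** A trigonometric function of Z_k with values in [0, 1], the argument fed to Bernstein
    polynomials; [dtheta] is its derivative with respect to Z_k. *)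
Definition theta k w := (1 + sin (a * Z k w)) / 2.
Definition dtheta k w := a * cos (a * Z k w) / 2.

Lemma theta01 k w : 0 <= theta k w <= 1.
Proof.
rewrite /theta; have := @sin_geN1 R (a * Z k w); have := @sin_le1 R (a * Z k w).
by move=> *; apply/andP; split; lra.
Qed.

Lemma dtheta_le k w : `|dtheta k w| <= `|a|.
Proof.
rewrite /dtheta -mulrA normrM ler_piMr// normrM.
have c1 : `|cos (a * Z k w)| <= 1 by rewrite normr_cos_le1.
by rewrite mulr_ile1// ger0_norm// invf_le1// ler1n.
Qed.

(** The factor theta passes from F to the test factor Q, which remains a trigonometric
    polynomial. *)
Lemma mul_stein_theta k F G : mul_stein F G ->
  mul_stein (fun w => theta k w * F w)
    (fun l w => theta k w * G l w + dtheta k w * F w *+ (l == k)).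
Proof.
move=> S Q Q' tQ.
have tQs := trigpair_lin (2^-1) (2^-1) tQ (trigpair_mul_sin a k tQ).
apply: stein_eq (S _ _ tQs) => [w|l w]; rewrite /theta /dtheta.
  by field.
by case: eqVneq => _; rewrite ?mulr1n ?mulr0n; field.
Qed.

(** The coefficients are random, as functions of the other coordinates will be. The gradient hence
    has one term from the coefficients and, along k, one from the argument theta. *)
Lemma mul_stein_bernstein k N (F : nat -> T -> R) (G : nat -> 'I_n -> T -> R) :
  (forall j, (j <= N)%N -> mul_stein (F j) (G j)) ->
  mul_stein (fun w => bernstein N (F ^~ w) (theta k w))
    (fun l w => bernstein N (fun j => G j l w) (theta k w) +
       dbernstein N (F ^~ w) (theta k w) * dtheta k w *+ (l == k)).
Proof.
elim: N F G => [|N IHN] F G S /=.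
  have := S 0%N isT; congr mul_stein; apply/funext => l; apply/funext => w.
  by rewrite mul0r mul0rn addr0.
have S1 := IHN (F \o succn) (G \o succn) (fun j jN => S j.+1 jN).
have S0 := IHN F G (fun j jN => S j (leqW jN)).
(* The recursion read as theta * S1 + (S0 - theta * S0). *)
have := mul_stein_lin 1 1 (mul_stein_theta k S1)
  (mul_stein_lin 1 (-1) S0 (mul_stein_theta k S0)).
congr mul_stein.
  by apply/funext => w /=; rewrite /comp; ring.
apply/funext => l; apply/funext => w /=; rewrite /comp.
by case: eqVneq => _; rewrite ?mulr1n ?mulr0n; ring.
Qed.

End TrigonometricPairs.

(** * Functions that are continuously differentiable along coordinate lines *)

Section SeparatelyC1.
Context (R : realType) (n : nat).
Implicit Types (H : ('I_n -> R) -> R) (D : 'I_n -> ('I_n -> R) -> R).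

(** Regularity is asked along coordinate lines because one coordinate is replaced at a time. Each D
    l must be continuous along every line, not only the l-th: when coordinate k is replaced, D l is
    approximated along k. Bounds are asked on the unit cube, where theta lives. *)
Record separately_C1 (M : R) H D : Prop := {
  sC1_derive : forall k x (t : R),
    is_derive t 1 (fun t => H (upd x k t)) (D k (upd x k t));
  sC1_continuous : forall k l x, continuous (fun t => D l (upd x k t));
  sC1_bounded : forall x, (forall i, 0 <= x i <= 1) -> `|H x| <= M;
  sC1_dbounded : forall x l, (forall i, 0 <= x i <= 1) -> `|D l x| <= M }.

Lemma sC1_continuousH M H D k x : separately_C1 M H D ->
  continuous (fun t => H (upd x k t)).
Proof.
move=> HD t; apply: differentiable_continuous; apply/derivable1_diffP.
by case: (sC1_derive HD k x t).
Qed.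

Lemma upd01 (x : 'I_n -> R) k t : (forall i, 0 <= x i <= 1) -> 0 <= t <= 1 ->
  forall i, 0 <= upd x k t i <= 1.
Proof. by move=> x01 t01 i; rewrite /upd; case: eqP. Qed.

Definition freeze H k t := fun x => H (upd x k t).
Definition dfreeze D k t := fun l x => if l == k then 0 else D l (upd x k t).

Lemma separately_C1_freeze M H D k t : 0 <= t <= 1 -> separately_C1 M H D ->
  separately_C1 M (freeze H k t) (dfreeze D k t).
Proof.
move=> t01 HD; split.
- move=> i x s; rewrite /freeze /dfreeze; case: eqVneq => [->|ik].
    under eq_fun do rewrite upd_upd; exact: is_derive_cst.
  rewrite updC//; under eq_fun do rewrite updC//.
  exact: sC1_derive HD i (upd x k t) s.
- move=> i l x; rewrite /dfreeze; case: eqP => _; first by move=> s; exact: cvg_cst.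
  have [->|ik] := eqVneq i k.
    by under eq_fun do rewrite upd_upd; move=> s; exact: cvg_cst.
  under eq_fun do rewrite updC//.
  exact: sC1_continuous HD i l (upd x k t).
- by move=> x x01; apply: (sC1_bounded HD); exact: upd01.
- move=> x l x01; rewrite /dfreeze; case: eqP => _.
    by rewrite normr0 (le_trans _ (sC1_bounded HD x01)).
  by apply: (sC1_dbounded HD); exact: upd01.
Qed.

End SeparatelyC1.

(** * Stein's identity for C^1 functions of theta *)

Section SteinC1.
Context d (T : measurableType d) (R : realType) (P : probability T R).
Variables (n : nat) (Y : T -> R) (c : 'I_n -> R) (Z : 'I_n -> T -> R).
Hypothesis gYZ : forall (lam : 'I_n -> R) (eps : R),
  centered_gaussian_rv P (fun w => \sum_l lam l * Z l w + eps * Y w).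
Hypothesis covYZ : forall l, \int[P]_w (Y w * Z l w) = c l.
Variable a : R.
Notation th w := (fun i => theta Z a i w).
Notation dth := (dtheta Z a).

(* Induction on the number [m] of coordinates that [H] still depends on: the
   last one is replaced by Bernstein polynomials. *)
Lemma mul_stein_separately_C1 m (M : R) H (D : 'I_n -> ('I_n -> R) -> R) : (m <= n)%N ->
  separately_C1 M H D ->
  (forall x y, (forall i : 'I_n, (i < m)%N -> x i = y i) -> H x = H y) ->
  (forall (l : 'I_n) x, (m <= l)%N -> D l x = 0) ->
  mul_stein P Y c Z (fun w => H (th w)) (fun l w => D l (th w) * dth l w).
Proof.
elim: m M H D => [|m IHm] M H D mn HD depH D0.
  have := mul_stein_cst gYZ covYZ (H (fun=> 0)).
  congr mul_stein; first by apply/funext => w; exact: depH.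
  by apply/funext => l; apply/funext => w; rewrite D0// mul0r.
pose k := Ordinal mn.
have th01 w i : 0 <= theta Z a i w <= 1 by exact: theta01.
have M0 : 0 <= M by rewrite (le_trans _ (sC1_bounded HD (x := fun=> 0) _))// lexx ler01.
have div01 N j : (j <= N)%N -> 0 <= (j%:R / N%:R : R) <= 1.
  move=> jN; rewrite divr_ge0//=.
  case: N jN => [|N jN]; first by rewrite invr0 mulr0.
  by rewrite ler_pdivrMr ?ltr0n// mul1r ler_nat.
(* Freezing coordinate k = m leaves a function of the first m coordinates, so the induction
   hypothesis applies to each Bernstein coefficient. *)
pose F N w := bernstein N (fun j => freeze H k (j%:R / N%:R) (th w)) (theta Z a k w).
pose G N l w := bernstein N (fun j => dfreeze D k (j%:R / N%:R) l (th w) * dth l w)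
    (theta Z a k w) +
  dbernstein N (fun j => freeze H k (j%:R / N%:R) (th w)) (theta Z a k w) *
    dth k w *+ (l == k).
have SFG N : mul_stein P Y c Z (F N) (G N).
  apply: (@mul_stein_bernstein _ _ _ _ _ _ _ _ a k N
    (fun j w => freeze H k (j%:R / N%:R) (th w))
    (fun j l w => dfreeze D k (j%:R / N%:R) l (th w) * dth l w)) => j jN.
  apply: (IHm M) => //; first exact: ltnW.
  - by apply: separately_C1_freeze => //; exact: div01.
  - move=> x y xy; apply: depH => i im; rewrite /upd; case: eqP => // /eqP ik.
    by apply: xy; rewrite ltn_neqAle -ltnS im andbT.
  - move=> l x ml; rewrite /dfreeze; case: eqVneq => // lk.
    by apply: D0; rewrite ltn_neqAle ml andbT eq_sym.
have thk w : H (th w) = H (upd (th w) k (theta Z a k w)).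
  by rewrite (_ : upd _ _ _ = th w) ?upd_same.
have thD l w : D l (th w) = D l (upd (th w) k (theta Z a k w)).
  by rewrite (_ : upd _ _ _ = th w) ?upd_same.
have upd01w w t : 0 <= t <= 1 -> forall i, 0 <= upd (th w) k t i <= 1.
  by move=> t01; apply: upd01.
apply: (@mul_stein_cvg _ _ _ _ _ _ _ _ gYZ F G _ _ (M + M * `|a|)) => //.
- move=> w; rewrite thk.
  apply: (bernstein_continuous_cvg (h := fun t => H (upd (th w) k t)) (M := M)) => //.
    by move=> t t01; apply: (sC1_bounded HD); exact: upd01w.
  exact: (sC1_continuousH HD).
- move=> l w; rewrite /G /dfreeze; case: eqVneq => [->|lk] /=.
    under eq_cvg do rewrite bernsteinZr bernstein_cst mul0r add0r mulr1n.
    apply: cvgMl; rewrite thD.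
    apply: (dbernstein_cvg (h := fun t => H (upd (th w) k t))
      (h' := fun t => D k (upd (th w) k t)) (M := M)) => //.
    + by move=> t; exact: (sC1_derive HD).
    + by move=> t t01; apply: (sC1_dbounded HD); exact: upd01w.
    + exact: (sC1_continuous HD).
  under eq_cvg do rewrite bernsteinZr mulr0n addr0.
  apply: cvgMl; rewrite thD.
  apply: (bernstein_continuous_cvg (h := fun t => D l (upd (th w) k t)) (M := M)) => //.
    by move=> t t01; apply: (sC1_dbounded HD); exact: upd01w.
  exact: (sC1_continuous HD).
- move=> N w; apply: (@le_trans _ _ M); last by rewrite lerDl mulr_ge0.
  apply: bernstein_norm_le => // j jN; apply: (sC1_bounded HD).
  by apply: upd01w; exact: div01.
- move=> N l w; rewrite /G /dfreeze (@le_trans _ _ (M * `|a|)) ?lerDr//.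
  case: eqVneq => [->|lk] /=.
    rewrite bernsteinZr bernstein_cst mul0r add0r mulr1n normrM ler_pM ?dtheta_le//.
    apply: (@dbernstein_norm_le _ _ ( fun t => H (upd (th w) k t))
      (fun t => D k (upd (th w) k t))) => //.
    + by move=> t; exact: (sC1_derive HD).
    + by move=> t t01; apply: (sC1_dbounded HD); exact: upd01w.
  rewrite mulr0n addr0 bernsteinZr normrM ler_pM ?dtheta_le//.
  apply: bernstein_norm_le => // j jN; apply: (sC1_dbounded HD).
  by apply: upd01w; exact: div01.
Qed.

End SteinC1.

(** * Row vectors, directional derivatives and the rescaled sine *)

Section RowVectors.
Variables (R : realType) (n : nat).

Lemma rV_norm_le (z : 'rV[R]_n) (r : R) : 0 <= r ->
  (forall i, `|z 0 i| <= r) -> `|z| <= r.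
Proof.
move=> r0 zr; rewrite /Num.norm/= mx_normrE; apply: bigmax_le => // -[i j] _ /=.
by rewrite (ord1 i).
Qed.

Lemma rV_coord_le (z : 'rV[R]_n) i : `|z 0 i| <= `|z|.
Proof.
rewrite [leRHS]/Num.norm/= mx_normrE.
exact: (@le_bigmax_cond _ _ _ 0 (0, i) xpredT (fun ij => `|z ij.1 ij.2|)).
Qed.

Lemma cvg_rV (F : set_system nat) (FF : Filter F) (u : nat -> 'I_n -> R) (v : 'I_n -> R) :
  (forall i, u m i @[m --> F] --> v i) ->
  (\row_i u m i : 'rV[R]_n) @[m --> F] --> (\row_i v i : 'rV[R]_n).
Proof.
move=> uv; apply/cvgrPdist_le => e e0.
have H : \forall m \near F, forall i, `|v i - u m i| <= e.
  by apply: filter_forall => i; move/cvgrPdist_le : (uv i); exact.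
near=> m; apply: rV_norm_le; first exact: ltW.
have Hm : forall i, `|v i - u m i| <= e by near: m.
by move=> i; rewrite !mxE.
Unshelve. all: by end_near. Qed.

Lemma is_derive_line (V : normedModType R) (h : V -> R) (b v : V) (t d : R) :
  is_derive (b + t *: v) v h d -> is_derive t 1 (fun s => h (b + s *: v)) d.
Proof.
move=> [dh hd].
have E : (fun s : R => s^-1 *: (h (b + (s *: 1 + t) *: v) - h (b + t *: v))) =
    fun s => s^-1 *: (h (s *: v + (b + t *: v)) - h (b + t *: v)).
  apply/funext => s; have -> : s *: (1 : R) = s by exact: mulr1.
  by rewrite scalerDl addrCA.
by split; rewrite /derivable /derive E.
Qed.

Lemma sin_norm_le (x : R) : `|sin x| <= `|x|.
Proof.
wlog x0 : x / 0 <= x => [H|].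
  by have [/H//|/ltW] := leP 0 x; rewrite -oppr_ge0 => /H; rewrite sinN !normrN.
have [|c _] := @MVT_segment R sin cos 0 x x0 (fun y _ => is_derive_sin y).
  by apply: continuous_subspaceT => y; exact: continuous_sin.
rewrite sin0 !subr0 => ->; rewrite normrM ler_piMl//.
exact: normr_cos_le1.
Qed.

(** The difference quotient at 0 of u |-> sin (u t), taken along u = 1 / (m + 1). *)
Lemma cvg_sin_rescaled (t : R) : m.+1%:R * sin (m.+1%:R^-1 * t) @[m --> \oo] --> t.
Proof.
have [df fd] : is_derive (0 : R) 1 (fun u : R => sin (u * t)) t.
  by apply: is_derive_eq; rewrite mul0r cos0 /GRing.scale/=; ring.
have : (fun u : R => u^-1 *: (sin ((u *: 1 + 0) * t) - sin (0 * t))) @ 0^' --> t.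
  by rewrite -[X in _ --> X]fd; exact: df.
move=> /cvgr_dnbhsP/(_ (fun m => m.+1%:R^-1)).
have h0 m : m.+1%:R^-1 != 0 :> R by rewrite invr_eq0.
move=> /(_ (conj h0 (@cvg_harmonic R))); apply: cvg_trans; apply: near_eq_cvg.
apply: nearW => m.
by rewrite /GRing.scale/= invrK mulr1 addr0 mul0r sin0 subr0.
Qed.

Lemma cvg_cos_rescaled (t : R) : cos (m.+1%:R^-1 * t) @[m --> \oo] --> (1 : R).
Proof.
rewrite -[X in _ --> X]cos0; apply: continuous_cvg; first exact: continuous_cos.
by rewrite -[X in _ --> X](mul0r t); apply: cvgMl; exact: cvg_harmonic.
Qed.

End RowVectors.

(** * Stein's identity for functions of polynomial growth *)

Section GaussianStein.
Context d (T : measurableType d) (R : realType) (P : probability T R).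
Variables (n : nat) (Y : T -> R) (c : 'I_n -> R) (Z : 'I_n -> T -> R).
Hypothesis gYZ : forall (lam : 'I_n -> R) (eps : R),
  centered_gaussian_rv P (fun w => \sum_l lam l * Z l w + eps * Y w).
Hypothesis covYZ : forall l, \int[P]_w (Y w * Z l w) = c l.
Variables (h : 'rV[R]_n -> R) (D : 'I_n -> 'rV[R]_n -> R) (C : R) (p : nat).
Hypothesis ch : continuous h.
Hypothesis cD : forall l, continuous (D l).
Hypothesis dh : forall l z, is_derive z (delta_mx 0 l) h (D l z).
Hypothesis hC : forall z, `|h z| <= C * (1 + `|z|) ^+ p.
Hypothesis DC : forall l z, `|D l z| <= C * (1 + `|z|) ^+ p.

Let C0 : 0 <= C.
Proof.
have := le_trans (normr_ge0 _) (hC 0).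
by rewrite normr0 addr0 expr1n mulr1.
Qed.

(** Maps the unit cube onto [-L, L]^n; at theta with a = 1 / L its coordinates are L sin (Z_i /
    L). *)
Let box (L : R) (x : 'I_n -> R) : 'rV[R]_n := \row_i (L * (2 * x i - 1)).

Let box_upd L x k t :
  box L (upd x k t) = box L (upd x k 0) + (2 * L * t) *: delta_mx 0 k.
Proof.
apply/rowP => i; rewrite !mxE/= /upd eq_sym; case: eqVneq => _.
  by rewrite mulr1; ring.
by rewrite mulr0 addr0.
Qed.

Let box_le L x : 0 <= L -> (forall i, 0 <= x i <= 1) -> `|box L x| <= L.
Proof.
move=> L0 x01; apply: rV_norm_le => // i; rewrite mxE normrM ger0_norm// ler_piMr//.
by have /andP[h0 h1] := x01 i; rewrite ler_norml; apply/andP; split; lra.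
Qed.

(** On the box, h and the D l are bounded by C (1 + L)^p; the chain rule brings the factor 2 L, and
    1 + 2 L covers values and derivatives alike. *)
Let separately_C1_box L : 0 <= L ->
  separately_C1 ((1 + 2 * L) * (C * (1 + L) ^+ p)) (fun x => h (box L x))
    (fun l x => 2 * L * D l (box L x)).
Proof.
move=> L0; have K0 : 0 <= C * (1 + L) ^+ p by rewrite mulr_ge0// exprn_ge0// addr_ge0.
have bnd (f : 'rV[R]_n -> R) x : (forall z, `|f z| <= C * (1 + `|z|) ^+ p) ->
    (forall i, 0 <= x i <= 1) -> `|f (box L x)| <= C * (1 + L) ^+ p.
  move=> fC x01; rewrite (le_trans (fC _))// ler_wpM2l//.
  by rewrite lerXn2r ?nnegrE ?addr_ge0// lerD2l box_le.
split.
- move=> k x t; rewrite box_upd; under eq_fun do rewrite box_upd.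
  have dl := is_derive_line (dh k (box L (upd x k 0) + (2 * L * t) *: delta_mx 0 k)).
  have dm : is_derive t 1 (fun s : R => 2 * L * s) (2 * L).
    by apply: is_derive_eq; rewrite /GRing.scale/=; ring.
  rewrite [X in is_derive _ _ _ X]mulrC.
  exact: (@is_derive1_comp _ (fun s => h (box L (upd x k 0) + s *: delta_mx 0 k))
    (fun s : R => 2 * L * s) t _ _ dl dm).
- move=> k l x t; apply: cvgMr.
  have cb : continuous (fun s : R => box L (upd x k 0) + (2 * L * s) *: delta_mx 0 k).
    move=> s; apply: cvgD; first exact: cvg_cst.
    by apply: cvgZr_tmp; apply: cvgMr; exact: cvg_id.
  rewrite [X in _ --> X]/= box_upd; under eq_cvg do rewrite box_upd.
  exact: (@continuous_comp _ _ _ _ (D l) t (cb t) (@cD l _)).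
- move=> x x01; rewrite (le_trans (bnd _ _ hC x01))// ler_peMl// lerDl mulr_ge0//.
- move=> x l x01; rewrite normrM ger0_norm ?mulr_ge0//.
  by rewrite ler_pM ?mulr_ge0// ?lerDr// bnd.
Qed.

Theorem gaussian_stein : stein P Y c (fun w => h (\row_i Z i w))
  (fun l w => D l (\row_i Z i w)).
Proof.
(* As |L sin (z / L)| <= |z|, this single majorant serves for all approximants and their
   gradients. *)
pose B w := C * (1 + \sum_i `|Z i w|) ^+ p.
have mB : all_moments P B.
  apply: all_momentsM; first exact: all_moments_cst.
  apply: all_momentsX; apply: all_momentsD; first exact: all_moments_cst.
  by apply: all_moments_sum => i; exact/all_moments_norm/all_moments_Z.
pose x m w : 'I_n -> R := fun i => m.+1%:R * sin (m.+1%:R^-1 * Z i w).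
have xZ w i : x m w i @[m --> \oo] --> Z i w by exact: cvg_sin_rescaled.
have cZ w : (\row_i x m w i : 'rV[R]_n) @[m --> \oo] --> (\row_i Z i w : 'rV[R]_n).
  by apply: cvg_rV => i; exact: xZ.
have xB m w : `|\row_i x m w i| <= \sum_i `|Z i w|.
  apply: rV_norm_le => [|i]; first by rewrite sumr_ge0.
  rewrite mxE /x normrM ger0_norm// (@le_trans _ _ `|Z i w|)//.
    rewrite (le_trans (ler_wpM2l _ (sin_norm_le _)))// normrM ger0_norm//.
    by rewrite mulVKf.
  by rewrite (bigD1 i)//= lerDl sumr_ge0.
have bnd (f : 'rV[R]_n -> R) m w : (forall z, `|f z| <= C * (1 + `|z|) ^+ p) ->
    `|f (\row_i x m w i)| <= B w.
  move=> fC; rewrite (le_trans (fC _))// ler_wpM2l//.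
  by rewrite lerXn2r ?nnegrE ?addr_ge0 ?sumr_ge0// lerD2l xB.
apply: (stein_cvg (F_ := fun m w => h (\row_i x m w i))
  (G_ := fun m l w => D l (\row_i x m w i) * cos (m.+1%:R^-1 * Z l w))
  (B := B) (B' := B)).
- move=> m; have L0 : 0 <= m.+1%:R :> R by [].
  have boxE w : box m.+1%:R (fun i => theta Z m.+1%:R^-1 i w) = \row_i x m w i.
    by apply/rowP => i; rewrite !mxE /theta /x; congr (_ * _); field.
  have depH (u v : 'I_n -> R) : (forall i : 'I_n, (i < n)%N -> u i = v i) ->
      h (box m.+1%:R u) = h (box m.+1%:R v).
    by move=> uv; congr (h (box _ _)); apply/funext => i; exact: uv.
  have D0 (l : 'I_n) (u : 'I_n -> R) : (n <= l)%N -> 2 * m.+1%:R * D l (box m.+1%:R u) = 0.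
    by rewrite leqNgt ltn_ord.
  (* All n coordinates are in use, so [D0] is vacuous. The chain rule factor 2 L cancels against
     [dtheta] and leaves cos (Z_l / L). *)
  have := mul_stein_separately_C1 gYZ covYZ m.+1%:R^-1 (leqnn n)
    (separately_C1_box L0) depH D0.
  move=> /mul_stein_stein; apply: stein_eq => [w|l w]; rewrite boxE//.
  by rewrite /dtheta; field.
- by move=> w; exact: (cvg_comp _ h (cZ w) (@ch _)).
- move=> l w; rewrite -[X in _ --> X]mulr1; apply: cvgM; last exact: cvg_cos_rescaled.
  exact: (cvg_comp _ (D l) (cZ w) (@cD l _)).
- by move=> m w; exact: bnd.
- move=> m l w; rewrite normrM (@le_trans _ _ `|D l (\row_i x m w i)|)//.
    by rewrite ler_piMr// normr_cos_le1.
  by apply: bnd => z; exact: DC.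
- apply/all_moments_rintegrable/all_momentsM => //.
  exact/all_moments_norm/(all_moments_Y gYZ).
- exact/all_moments_rintegrable.
Qed.

End GaussianStein.

(** * Symmetry of second derivatives *)

Section MixedPartials.
Variables (R : realType) (V : normedModType R).

(** The mean value theorem twice: along u for the increment of g in direction v, then along v for
    gu. *)
Lemma second_difference (g gu guv : V -> R) (u v z : V) (s : R) : 0 < s ->
  (forall y, is_derive y u g (gu y)) -> (forall y, is_derive y v gu (guv y)) ->
  exists a b, [/\ 0 <= a <= s, 0 <= b <= s &
    g (z + s *: u + s *: v) - g (z + s *: u) - (g (z + s *: v) - g z) =
    s ^+ 2 * guv (z + a *: u + b *: v)].
Proof.
move=> s0 du duv.
pose phi t := g (z + s *: v + t *: u) - g (z + t *: u).
have dphi (t : R) : is_derive t 1 phi (gu (z + s *: v + t *: u) - gu (z + t *: u)).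
  by apply: is_deriveB; apply: is_derive_line.
have [|a a0s] := MVT s0 (fun t _ => dphi t).
  by apply: derivable_within_continuous => t _; exact: ex_derive.
pose psi t := gu (z + a *: u + t *: v).
have dpsi (t : R) : is_derive t 1 psi (guv (z + a *: u + t *: v)).
  exact: is_derive_line.
have [|b b0s] := MVT s0 (fun t _ => dpsi t).
  by apply: derivable_within_continuous => t _; exact: ex_derive.
rewrite /phi /psi !scale0r !addr0 subr0 => E1 E2; exists a, b; split.
- by move: a0s; rewrite in_itv/= => /andP[/ltW-> /ltW->].
- by move: b0s; rewrite in_itv/= => /andP[/ltW-> /ltW->].
- rewrite (addrAC z (s *: u)) E2 (addrAC z (s *: v)) E1.
  by ring.
Qed.

(** The second difference is symmetric in u and v, so guv and gvu take a common value at points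
    arbitrarily close to z; continuity at z concludes. *)
Lemma mixed_partialC (g gu gv guv gvu : V -> R) (u v z : V) :
  (forall y, is_derive y u g (gu y)) -> (forall y, is_derive y v gu (guv y)) ->
  (forall y, is_derive y v g (gv y)) -> (forall y, is_derive y u gv (gvu y)) ->
  {for z, continuous guv} -> {for z, continuous gvu} -> guv z = gvu z.
Proof.
move=> du duv dv dvu cuv cvu; apply/eqP; rewrite -subr_eq0 -normr_le0.
apply/ler_addgt0Pr => e e0; rewrite add0r.
have e20 : 0 < e / 2 by rewrite divr_gt0.
have /cvgrPdist_le/(_ _ e20)/nbhs_normP[r1 /= r10 H1] := cuv.
have /cvgrPdist_le/(_ _ e20)/nbhs_normP[r2 /= r20 H2] := cvu.
(* With s K = r / 2, all intermediate points of both second differences lie within r of z. The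
   summand 1 keeps K positive when u = v = 0. *)
pose K := 1 + `|u| + `|v|.
have K0 : 0 < K by rewrite /K -addrA ltr_pwDl// addr_ge0.
pose r := Num.min r1 r2.
have r0 : 0 < r by rewrite lt_min r10 r20.
pose s := r / (2 * K).
have s0 : 0 < s by rewrite divr_gt0// mulr_gt0.
have near_z a b : 0 <= a <= s -> 0 <= b <= s -> `|z - (z + a *: u + b *: v)| < r.
  move=> /andP[a0 sa] /andP[b0 sb]; rewrite -addrA opprD addrA subrr sub0r normrN.
  rewrite (le_lt_trans (ler_normD _ _))// !normrZ !ger0_norm//.
  apply: (@le_lt_trans _ _ (s * K)).
    rewrite /K -addrA mulrDr mulr1 -[leLHS]add0r lerD ?(ltW s0)// mulrDr.
    by rewrite lerD// ler_wpM2r.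
  rewrite /s invfM mulrA -mulrA mulVf ?gt_eqF// mulr1.
  by rewrite ltr_pdivrMr// ltr_pMr// ltr1n.
have [a [b [a0s b0s E1]]] := second_difference z s0 du duv.
have [b' [a' [b0s' a0s' E2]]] := second_difference z s0 dv dvu.
have E : guv (z + a *: u + b *: v) = gvu (z + b' *: v + a' *: u).
  apply: (@mulfI _ (s ^+ 2)); first by rewrite expf_neq0// gt_eqF.
  by rewrite -E1 -E2 (addrAC z (s *: v)); ring.
have b1 : `|guv z - guv (z + a *: u + b *: v)| <= e / 2.
  by apply: H1; rewrite /= (lt_le_trans (near_z _ _ a0s b0s))// ge_min lexx.
have b2 : `|gvu z - gvu (z + b' *: v + a' *: u)| <= e / 2.
  apply: H2; rewrite /= (addrAC z) (lt_le_trans (near_z _ _ a0s' b0s'))//.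
  by rewrite ge_min lexx orbT.
rewrite (le_trans (ler_distD (guv (z + a *: u + b *: v)) _ _))// [leRHS]splitr.
by rewrite lerD// E distrC.
Qed.

End MixedPartials.

(** * From the Gaussian property to the formula *)

Section SmoothPoly.
Variables (R : realType) (n : nat).

Lemma common_poly_bound (I : finType) (f : I -> 'rV[R]_n -> R) :
  (forall i, exists (C : R) (m : nat), forall z, `|f i z| <= C * (1 + `|z|) ^+ m) ->
  exists (C : R) (m : nat), forall i z, `|f i z| <= C * (1 + `|z|) ^+ m.
Proof.
move=> H.
have [C HC] := choice H; have [m Hm] := choice HC.
(* Since 1 + |z| >= 1, enlarging both the constant and the exponent only weakens the bound. *)
exists (\sum_i `|C i|), (\sum_i m i)%N => i z; rewrite (le_trans (Hm i z))//.
have z1 : 1 <= 1 + `|z| by rewrite lerDl.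
rewrite (@le_trans _ _ (`|C i| * (1 + `|z|) ^+ m i)) ?ler_wpM2r ?ler_norm ?exprn_ge0 ?addr_ge0//.
rewrite ler_pM ?exprn_ge0 ?addr_ge0//.
  by rewrite (bigD1 i)//= lerDl sumr_ge0.
by rewrite ler_weXn2l// (bigD1 i)//= leq_addr.
Qed.

Variable h : 'rV[R]_n -> R.
Hypothesis sh : smooth_poly h.

Lemma smooth_partial_continuous (s : seq 'I_n) : continuous (iter_partial s h).
Proof. by case: (sh s). Qed.

Lemma smooth_partial_derive (s : seq 'I_n) k z :
  is_derive z (delta_mx 0 k) (iter_partial s h) (iter_partial (k :: s) h z).
Proof. by split; [case: (sh s) => _ + _; exact|]. Qed.

Lemma partialC k l : partial k (partial l h) = partial l (partial k h).
Proof.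
apply/funext => z.
apply: (@mixed_partialC _ _ h (partial l h) (partial k h) _ _ (delta_mx 0 l) (delta_mx 0 k)).
- by move=> y; exact: (smooth_partial_derive [::]).
- by move=> y; exact: (smooth_partial_derive [:: l]).
- by move=> y; exact: (smooth_partial_derive [::]).
- by move=> y; exact: (smooth_partial_derive [:: k]).
- exact: (@smooth_partial_continuous [:: k; l] z).
- exact: (@smooth_partial_continuous [:: l; k] z).
Qed.

End SmoothPoly.

(** * Reduction of the formula to real-valued functionals *)

Section ComplexParts.
Variable R : realType.
Local Open Scope complex_scope.

Lemma Re_mulC (z : R[i]) (r : R) : complex.Re (z * r%:C) = complex.Re z * r.
Proof. by case: z => a b /=; rewrite mulr0 subr0. Qed.

Lemma Im_mulC (z : R[i]) (r : R) : complex.Im (z * r%:C) = complex.Im z * r.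
Proof. by case: z => a b /=; rewrite mulr0 add0r. Qed.

Lemma Re_sum (I : Type) (s : seq I) (f : I -> R[i]) :
  complex.Re (\sum_(i <- s) f i) = \sum_(i <- s) complex.Re (f i).
Proof. exact: raddf_sum. Qed.

Lemma Im_sum (I : Type) (s : seq I) (f : I -> R[i]) :
  complex.Im (\sum_(i <- s) f i) = \sum_(i <- s) complex.Im (f i).
Proof. exact: raddf_sum. Qed.

Variables (n : nat) (g : 'rV[R]_n -> R[i]) (e : 'I_n -> step R R).

(** Path, kernel and step functions are real, so the formula for g splits into the same real formula
    for Re g and for Im g; [rlhs] and [rintegrand] are its two sides. *)
Definition rlhs (h : 'rV[R]_n -> R) (t : R) (x : R -> R) : R :=
  \sum_k step_val (e k) t * (x t * partial k h (zvec e x)).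

Definition rintegrand (K : R -> R -> R) (h : 'rV[R]_n -> R) (t : R) (x : R -> R) (s : R) : R :=
  \sum_l \sum_(p <- e l) (\sum_k partial k (partial l h) (zvec e x) * step_val (e k) t) *
    p.1 * (K t s * K p.2 s).

Lemma Re_lhs t x : complex.Re ((x t)%:C * Dfun g e t x) =
  rlhs (fun z => complex.Re (g z)) t x.
Proof.
rewrite mulrC Re_mulC /Dfun Re_sum mulr_suml; apply: eq_bigr => k _.
by rewrite Re_mulC /=; ring.
Qed.

Lemma Im_lhs t x : complex.Im ((x t)%:C * Dfun g e t x) =
  rlhs (fun z => complex.Im (g z)) t x.
Proof.
rewrite mulrC Im_mulC /Dfun Im_sum mulr_suml; apply: eq_bigr => k _.
by rewrite Im_mulC /=; ring.
Qed.

Lemma KstarE K t x s : Kstar K (D2fun g e t x) s =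
  \sum_l \sum_(p <- e l) (\sum_k cpartial k (cpartial l g) (zvec e x) *
    (step_val (e k) t)%:C) * (p.1)%:C * (K p.2 s)%:C.
Proof. by rewrite /Kstar /step_lin /D2fun big_allpairs_dep /= big_enum. Qed.

Lemma Re_integrand K t x s : complex.Re ((K t s)%:C * Kstar K (D2fun g e t x) s) =
  rintegrand K (fun z => complex.Re (g z)) t x s.
Proof.
rewrite mulrC Re_mulC KstarE Re_sum mulr_suml; apply: eq_bigr => l _.
rewrite Re_sum mulr_suml; apply: eq_bigr => p _.
rewrite !Re_mulC Re_sum.
under eq_bigr do rewrite Re_mulC /=.
by ring.
Qed.

Lemma Im_integrand K t x s : complex.Im ((K t s)%:C * Kstar K (D2fun g e t x) s) =
  rintegrand K (fun z => complex.Im (g z)) t x s.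
Proof.
rewrite mulrC Im_mulC KstarE Im_sum mulr_suml; apply: eq_bigr => l _.
rewrite Im_sum mulr_suml; apply: eq_bigr => p _.
rewrite !Im_mulC Im_sum.
under eq_bigr do rewrite Im_mulC /=.
by ring.
Qed.

End ComplexParts.

(** * The real formula for a Gaussian process *)

Section GaussianToIbp.
Context (R : realType) d (T : measurableType d) (P : probability T R).
Variables (I : set R) (K : R -> R -> R) (X : R -> T -> R).
Hypothesis GK : gaussian_with_fredholm_kernel P I K X.
Notation mu := (@lebesgue_measure R).

Definition fredholm_cov (K : R -> R -> R) (t s : R) : R :=
  \int[mu]_(u in `[0, 1]) (K t u * K s u).

Lemma centered_gaussian_step (s : step R R) : step_nodes I s ->
  centered_gaussian_rv P (fun w => step_int s (X ^~ w)).
Proof.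
move=> sI; have [+ _] := GK.
move=> /(_ (size s) (fun i => (tnth (in_tuple s) i).2) (fun i => (tnth (in_tuple s) i).1)).
move=> /(_ (fun i => sI _ (mem_tnth i (in_tuple s)))).
congr centered_gaussian_rv; apply/funext => w.
by rewrite /step_int /step_lin [in RHS](big_tnth _ _ s).
Qed.

Lemma integrable_cov t u : I t -> I u ->
  rintegrable mu `[0, 1] (fun v => K t v * K u v).
Proof. by move=> It Iu; have [_ /(_ t u It Iu)[]] := GK. Qed.

Lemma all_moments_process t : I t -> all_moments P (X t).
Proof.
move=> It; apply: all_moments_gaussian_rv.
have := @centered_gaussian_step [:: (1, t)]; rewrite /step_int /step_lin.
under eq_fun do rewrite big_seq1 mul1r; apply => p.
by rewrite inE => /eqP->.
Qed.

Lemma expectation_process t u : I t -> I u ->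
  \int[P]_w (X t w * X u w) = fredholm_cov K t u.
Proof.
move=> It Iu; have [_ /(_ t u It Iu)[_]] := GK.
by rewrite unlock /fredholm_cov /Rintegral => ->.
Qed.

Variables (t : R) (It : I t) (n : nat) (e : 'I_n -> step R R).
Hypothesis eI : forall k, step_nodes I (e k).

Let Z l w := step_int (e l) (X ^~ w).
Let c l := \sum_(p <- e l) p.1 * fredholm_cov K t p.2.

Lemma gaussian_step_combination (lam : 'I_n -> R) (eps : R) :
  centered_gaussian_rv P (fun w => \sum_l lam l * Z l w + eps * X t w).
Proof.
(* A combination of step integrals and of X t is the integral of one step function, obtained by
   concatenation. *)
pose s := (eps, t) :: [seq (lam l * p.1, p.2) | l <- enum 'I_n, p <- e l].
have sI : step_nodes I s.
  move=> p; rewrite inE => /predU1P[->//|/allpairsPdep[l [q [_ ql ->]]]].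
  exact: (eI ql).
have := centered_gaussian_step sI; congr centered_gaussian_rv.
apply/funext => w; rewrite /step_int /step_lin /s big_cons /= addrC.
congr (_ + _); rewrite big_allpairs_dep /= big_enum; apply: eq_bigr => l _.
by rewrite mulr_sumr; apply: eq_bigr => p _; rewrite /= mulrA.
Qed.

Lemma covariance_step l : \int[P]_w (X t w * Z l w) = c l.
Proof.
rewrite /Z /c /step_int /step_lin; move: (e l) (@eI l) => s.
elim: s => [|p s IHs] sI.
  by under eq_Rintegral do rewrite big_nil mulr0; rewrite big_nil Rintegral_cst// mul0r.
have Ip : I p.2 by apply: sI; rewrite inE eqxx.
have {}sI : step_nodes I s by move=> q qs; apply: sI; rewrite inE qs orbT.
have I1 : rintegrable P setT (fun w => X t w * X p.2 w).
  by apply: all_moments_rintegrable; apply: all_momentsM; exact: all_moments_process.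
have I2 : rintegrable P setT (fun w => X t w * \sum_(q <- s) q.1 * X q.2 w).
  apply: all_moments_rintegrable; apply: all_momentsM; first exact: all_moments_process.
  exact/all_moments_gaussian_rv/centered_gaussian_step.
transitivity (\int[P]_w (p.1 * (X t w * X p.2 w) + X t w * \sum_(q <- s) q.1 * X q.2 w)).
  by apply: eq_Rintegral => w _; rewrite big_cons; ring.
rewrite RintegralD//; last exact: rintegrableZ.
by rewrite RintegralZl// expectation_process// IHs// big_cons.
Qed.

Lemma stein_partial (h : 'rV[R]_n -> R) k : smooth_poly h ->
  stein P (X t) c (fun w => partial k h (zvec e (X ^~ w)))
    (fun l w => partial l (partial k h) (zvec e (X ^~ w))).
Proof.
move=> sh.
(* [None] indexes [partial k h] itself and [Some l] its derivatives, so that one constant and one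
   exponent bound them all. *)
pose f (i : option 'I_n) := if i is Some l then partial l (partial k h) else partial k h.
have [|C [p Hf]] := @common_poly_bound _ _ _ f.
  by case=> [l|]; [have [_ _] := sh [:: l; k]|have [_ _] := sh [:: k]].
apply: (@gaussian_stein _ _ _ P n (X t) c Z gaussian_step_combination covariance_step
  (partial k h) (fun l => partial l (partial k h)) C p).
- by move=> z; exact: (@smooth_partial_continuous _ _ _ sh [:: k] z).
- by move=> l z; exact: (@smooth_partial_continuous _ _ _ sh [:: l; k] z).
- by move=> l z; exact: (smooth_partial_derive sh [:: k]).
- by move=> z; exact: (Hf None).
- by move=> l z; exact: (Hf (Some l)).
Qed.

Lemma rintegrable_rintegrand h w :
  rintegrable mu `[0, 1] (rintegrand e K h t (X ^~ w)).
Proof.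
apply: rintegrable_sum => // l _; apply: rintegrable_sum => // p pe.
by apply: rintegrableZ => //; apply: integrable_cov => //; exact: (eI pe).
Qed.

Lemma Rintegral_rintegrand h w : smooth_poly h ->
  \int[mu]_(s in `[0, 1]) rintegrand e K h t (X ^~ w) s =
  \sum_l c l * \sum_k step_val (e k) t * partial l (partial k h) (zvec e (X ^~ w)).
Proof.
move=> sh.
have Ip l p a : p \in e l -> rintegrable mu `[0, 1] (fun s => a * (K t s * K p.2 s)).
  by move=> pe; apply: rintegrableZ => //; apply: integrable_cov => //; exact: (eI pe).
rewrite /rintegrand Rintegral_sum//; last first.
  by move=> l _; apply: rintegrable_sum => // p pe; exact: (Ip l p _ pe).
apply: eq_bigr => l _; rewrite Rintegral_sum//; last by move=> p pe; exact: (Ip l p _ pe).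
rewrite /c mulr_suml big_seq [RHS]big_seq; apply: eq_bigr => p pe.
rewrite RintegralZl//; last by apply: integrable_cov => //; exact: (eI pe).
(* Symmetry puts the second derivatives in the order in which [stein_partial] produces them. *)
under eq_bigr do rewrite partialC// mulrC.
by rewrite /fredholm_cov; ring.
Qed.

Lemma real_ibp (h : 'rV[R]_n -> R) : smooth_poly h ->
  [/\ rintegrable P setT (fun w => rlhs e h t (X ^~ w)),
      rintegrable P setT
        (fun w => \int[mu]_(s in `[0, 1]) rintegrand e K h t (X ^~ w) s) &
      \int[P]_w rlhs e h t (X ^~ w) =
      \int[P]_w \int[mu]_(s in `[0, 1]) rintegrand e K h t (X ^~ w) s].
Proof.
move=> sh; have S k := stein_partial k sh.
have IF k : rintegrable P setT (fun w => X t w * partial k h (zvec e (X ^~ w))).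
  by case: (S k).
have IG k l : rintegrable P setT (fun w => partial l (partial k h) (zvec e (X ^~ w))).
  by case: (S k).
have IGs l : rintegrable P setT (fun w => \sum_k step_val (e k) t *
    partial l (partial k h) (zvec e (X ^~ w))).
  by apply: rintegrable_sum => // k _; exact: rintegrableZ.
have rE : (fun w => \int[mu]_(s in `[0, 1]) rintegrand e K h t (X ^~ w) s) =
    fun w => \sum_l c l * \sum_k step_val (e k) t * partial l (partial k h) (zvec e (X ^~ w)).
  by apply/funext => w; rewrite Rintegral_rintegrand.
split.
- by apply: rintegrable_sum => // k _; exact: rintegrableZ.
- by rewrite rE; apply: rintegrable_sum => // l _; exact: rintegrableZ.
- rewrite rE !Rintegral_sum//; try by move=> l _; exact: rintegrableZ.
  transitivity (\sum_k step_val (e k) t *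
      \sum_l c l * \int[P]_w partial l (partial k h) (zvec e (X ^~ w))).
    apply: eq_bigr => k _; rewrite RintegralZl//; last exact: IF.
    by case: (S k) => _ _ ->.
  under eq_bigr do rewrite mulr_sumr; rewrite exchange_big /=.
  apply: eq_bigr => l _; rewrite RintegralZl//; last exact: IGs.
  rewrite Rintegral_sum//; last by move=> k _; exact: rintegrableZ.
  rewrite mulr_sumr; apply: eq_bigr => k _.
  by rewrite RintegralZl//; [ring|exact: IG].
Qed.

End GaussianToIbp.

Theorem fredholm_gaussian_ibp (R : realType) d (T : measurableType d)
    (P : probability T R) (I : set R) (K : R -> R -> R) (X : R -> T -> R) :
  gaussian_with_fredholm_kernel P I K X -> malliavin_ibp P I K X.
Proof.
move=> GK t It n g e [sRe sIm] eI.
have eI' k : step_nodes I (e k) by move=> p /(eI k)[].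
have [L1 R1 E1] := real_ibp GK It eI' sRe.
have [L2 R2 E2] := real_ibp GK It eI' sIm.
split.
- split; [move: L1|move: L2]; apply: eq_integrable => // w _.
    by rewrite /= Re_lhs.
  by rewrite /= Im_lhs.
- apply: aeW => w; split.
    move: (rintegrable_rintegrand GK It eI' (fun z => complex.Re (g z)) w).
    by apply: eq_integrable => // s _; rewrite /= Re_integrand.
  move: (rintegrable_rintegrand GK It eI' (fun z => complex.Im (g z)) w).
  by apply: eq_integrable => // s _; rewrite /= Im_integrand.
- split; [move: R1|move: R2]; apply: eq_integrable => // w _ /=; congr EFin.
    by apply: eq_Rintegral => s _; rewrite Re_integrand.
  by apply: eq_Rintegral => s _; rewrite Im_integrand.
- rewrite /cintegral; congr (_ +i* _)%C.
    under eq_Rintegral do rewrite Re_lhs.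
    rewrite E1; apply: eq_Rintegral => w _ /=; apply: eq_Rintegral => s _.
    by rewrite Re_integrand.
  under eq_Rintegral do rewrite Im_lhs.
  rewrite E2; apply: eq_Rintegral => w _ /=; apply: eq_Rintegral => s _.
  by rewrite Im_integrand.
Qed.

(** * From the formula to the Gaussian property *)

Section SmoothFamilies.
Variable R : realType.

(** F m is the m-th derivative of F 0. Having all derivatives in closed form reduces smoothness of a
    functional of one integral to an induction on the order. *)
Record smooth_family (F : nat -> R -> R) : Prop := {
  sf_derive : forall m (x : R), is_derive x 1 (F m) (F m.+1 x);
  sf_bound : forall m, exists (C : R) (p : nat), forall x, `|F m x| <= C * (1 + `|x|) ^+ p }.

Lemma is_derive_coord0 (f : R -> R) (d : R) (k : 'I_1) (z : 'rV[R]_1) :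
  is_derive (z 0 0) 1 f d ->
  is_derive z (delta_mx 0 k) (fun z : 'rV[R]_1 => f (z 0 0)) d.
Proof.
move=> [df fd].
have E : (fun h : R => h^-1 *: (f ((h *: delta_mx 0 k + z : 'rV[R]_1) 0 0) - f (z 0 0))) =
    fun h => h^-1 *: (f (h *: 1 + z 0 0) - f (z 0 0)).
  by apply/funext => h; rewrite !mxE (ord1 k).
by split; rewrite /derivable /derive E.
Qed.

Variable F : nat -> R -> R.
Hypothesis sF : smooth_family F.

Lemma partial_coord0 m (k : 'I_1) :
  partial k (fun z : 'rV[R]_1 => F m (z 0 0)) = fun z => F m.+1 (z 0 0).
Proof.
apply/funext => z; rewrite /partial.
by have /@derive_val := is_derive_coord0 k (sf_derive sF m (z 0 0)).
Qed.

Lemma iter_partial_coord0 (s : seq 'I_1) :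
  iter_partial s (fun z : 'rV[R]_1 => F 0 (z 0 0)) = fun z => F (size s) (z 0 0).
Proof. by elim: s => //= k s ->; exact: partial_coord0. Qed.

Lemma smooth_family_poly : smooth_poly (fun z : 'rV[R]_1 => F 0 (z 0 0)).
Proof.
move=> s; rewrite iter_partial_coord0; split.
- move=> z; have cF : continuous (F (size s)).
    move=> x; apply: differentiable_continuous; apply/derivable1_diffP.
    by case: (sf_derive sF (size s) x).
  exact: (@continuous_comp _ _ _ (fun z : 'rV[R]_1 => z 0 0) (F (size s)) z
    (@coord_continuous _ _ _ 0 0 z) (cF _)).
- by move=> k z; case: (is_derive_coord0 k (sf_derive sF (size s) (z 0 0))).
- have [C [p H]] := sf_bound sF (size s); exists C, p => z.
  have C0 : 0 <= C.
    have := le_trans (normr_ge0 _) (H 0).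
    by rewrite normr0 addr0 expr1n mulr1.
  rewrite (le_trans (H _))// ler_wpM2l// lerXn2r ?nnegrE ?addr_ge0//.
  by rewrite lerD2l rV_coord_le.
Qed.

End SmoothFamilies.

Section SmoothFamilyExamples.
Variable R : realType.

(** The formula involves F 1 and F 2 only: a = 0, b = 1 tests the mean, and a = 1, b = 0 the
    covariance. *)
Definition quadratic_family (a b : R) (m : nat) (x : R) : R :=
  match m with
  | 0 => a * x ^+ 2 / 2 + b * x
  | 1 => a * x + b
  | 2 => a
  | _ => 0
  end.

Lemma smooth_quadratic_family a b : smooth_family (quadratic_family a b).
Proof.
split=> [m x|m].
  case: m => [|[|[|m]]] /=.
  - by apply: is_derive_eq; rewrite /GRing.scale/=; field.
  - by apply: is_derive_eq; rewrite /GRing.scale/=; ring.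
  - exact: is_derive_cst.
  - exact: is_derive_cst.
exists (`|a| + `|b|), 2%N => x.
have x0 := normr_ge0 x; have a0 := normr_ge0 a; have b0 := normr_ge0 b.
have X2 : 0 <= `|x| ^+ 2 by rewrite sqr_ge0.
case: m => [|[|[|m]]] /=.
- have e1 : `|a * x ^+ 2 / 2| = `|a| * `|x| ^+ 2 / 2.
    by rewrite normrM (@normrM _ a) normrX [X in _ * X = _]ger0_norm.
  by rewrite (le_trans (ler_normD _ _))// e1 normrM; nra.
- by rewrite (le_trans (ler_normD _ _))// !normrM; nra.
- by nra.
- by rewrite normr0; nra.
Qed.

(** Each derivative advances the phase by a quarter turn. The free phase u covers cosine and sine at
    once. *)
Definition cosine_family (lam u : R) (m : nat) (x : R) : R :=
  lam ^+ m * cos (lam * x + u + m%:R * (pi / 2)).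

Lemma smooth_cosine_family lam u : smooth_family (cosine_family lam u).
Proof.
split=> [m x|m].
  have -> : cosine_family lam u m.+1 x =
      - (lam ^+ m.+1 * sin (lam * x + u + m%:R * (pi / 2))).
    rewrite -mulrN -cosDpihalf /cosine_family -natr1; congr (_ * cos _).
    by ring.
  by apply: is_derive_eq; rewrite /GRing.scale/= exprS; ring.
exists (`|lam| ^+ m), 0%N => x; rewrite expr0 mulr1 normrM normrX ler_piMr ?exprn_ge0//.
exact: normr_cos_le1.
Qed.

Lemma cosine_family1 lam u x : cosine_family lam u 1 x = - lam * sin (lam * x + u).
Proof.
have -> : cosine_family lam u 1 x = lam * cos (lam * x + u + pi / 2).
  by rewrite /cosine_family; congr (_ * cos (_ + _)); field.
by rewrite cosDpihalf mulrN mulNr.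
Qed.

Lemma cosine_family2 lam u x : cosine_family lam u 2 x = - lam ^+ 2 * cos (lam * x + u).
Proof.
have -> : cosine_family lam u 2 x = lam ^+ 2 * cos (lam * x + u + pi).
  by rewrite /cosine_family; congr (_ * cos (_ + _)); field.
by rewrite cosDpi mulrN mulNr.
Qed.

End SmoothFamilyExamples.

(** * Mean and covariance from the formula *)

Section IbpToGaussian.
Context (R : realType) d (T : measurableType d) (P : probability T R).
Variables (K : R -> R -> R) (X : R -> T -> R).
Notation mu := (@lebesgue_measure R).
Notation J := (`]0, 1[%classic : set R).
Hypothesis ibp : malliavin_ibp P J K X.
Hypothesis mX : forall t, J t -> measurable_fun setT (X t).

Let cov := fredholm_cov K.

(** The formula for n = 1 and real g. The factor [step_val s t] is kept on both sides, since it may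
    vanish. *)
Lemma ibp_smooth_family (F : nat -> R -> R) (t : R) (s : step R R) :
  smooth_family F -> J t -> step_nodes J s ->
  [/\ rintegrable P setT (fun w => step_val s t * (X t w * F 1%N (step_int s (X ^~ w)))),
      {ae P, forall w, rintegrable mu `[0, 1] (fun v => \sum_(p <- s)
         F 2%N (step_int s (X ^~ w)) * step_val s t * p.1 * (K t v * K p.2 v))} &
      \int[P]_w (step_val s t * (X t w * F 1%N (step_int s (X ^~ w)))) =
      \int[P]_w \int[mu]_(v in `[0, 1]) (\sum_(p <- s)
         F 2%N (step_int s (X ^~ w)) * step_val s t * p.1 * (K t v * K p.2 v))].
Proof.
move=> sF Jt Js.
pose g (z : 'rV[R]_1) : R[i] := (F 0%N (z 0 0) +i* 0)%C.
pose e (_ : 'I_1) := s.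
have z0 : smooth_family (fun (_ : nat) (_ : R) => 0 : R).
  split; first by move=> m x; exact: is_derive_cst.
  by move=> m; exists 0, 0%N => x; rewrite normr0 mul0r.
have sg : csmooth_poly g.
  split; first exact: (smooth_family_poly sF).
  exact: (smooth_family_poly z0).
have eJ k : step_nodes (J `&` `]0, 1]) (e k).
  move=> p /Js Jp; split=> //; move: Jp; rewrite /= !in_itv/= => /andP[-> /ltW->].
  by [].
have zE w : (zvec e (X ^~ w)) 0 0 = step_int s (X ^~ w) by rewrite mxE.
have lE w : rlhs e (fun z => complex.Re (g z)) t (X ^~ w) =
    step_val s t * (X t w * F 1%N (step_int s (X ^~ w))).
  by rewrite /rlhs big_ord1 (partial_coord0 sF 0) zE.
have rE w v : rintegrand e K (fun z => complex.Re (g z)) t (X ^~ w) v =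
    \sum_(p <- s) F 2%N (step_int s (X ^~ w)) * step_val s t * p.1 * (K t v * K p.2 v).
  rewrite /rintegrand big_ord1; apply: eq_bigr => p _.
  by rewrite big_ord1 (partial_coord0 sF 0) (partial_coord0 sF 1) zE.
have [[L1 _] A1 [R1 _] E1] := ibp Jt sg eJ; split.
- move: L1; apply: eq_integrable => // w _; rewrite /= -lE -Re_lhs.
  by [].
- apply: filterS A1 => w [+ _]; apply: eq_integrable => // v _.
  by rewrite /= -rE -Re_integrand.
- have := congr1 (@complex.Re R) E1; rewrite /cintegral /=.
  under eq_Rintegral do rewrite (Re_lhs g e) lE.
  move=> ->; apply: eq_Rintegral => w _; apply: eq_Rintegral => v _ /=.
  by rewrite -rE -Re_integrand.
Qed.

(** Used to extract the deterministic integrability of kernel products from an almost sure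
    clause. *)
Lemma ae_cst (A : Prop) : {ae P, forall w : T, A} -> A.
Proof.
move=> [N [mN N0 AN]]; apply: contrapT => nA.
have NT : N = setT by rewrite -subTset => w _; apply: AN => /=.
by move: N0; rewrite NT probability_setT => /eqP; rewrite onee_eq0.
Qed.

(** A step function that is nonzero at t needs a node beyond t; this is where the interval must be
    open at 1. *)
Lemma exists_later (t u : R) : J t -> J u -> exists v, [/\ J v, t < v & u < v].
Proof.
rewrite /= !in_itv/= => /andP[t0 t1] /andP[u0 u1].
have [tu|ut] := leP t u.
  by exists ((u + 1) / 2); rewrite in_itv/=; split; [apply/andP; split| |]; lra.
by exists ((t + 1) / 2); rewrite in_itv/=; split; [apply/andP; split| |]; lra.
Qed.

Lemma step_val1 (t v : R) : J t -> t < v -> step_val [:: (1, v)] t = 1 :> R.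
Proof.
rewrite /= in_itv/= => /andP[t0 _] tv.
by rewrite /step_val big_seq1 in_itv/= (ltW t0) tv.
Qed.

Lemma step_val2_neq0 (t u v : R) : J t -> t < v -> step_val [:: (1, v); (1, u)] t != 0 :> R.
Proof.
rewrite /= in_itv/= => /andP[t0 _] tv.
rewrite /step_val !big_cons big_nil addr0 in_itv/= (ltW t0) tv mulr1n.
by rewrite gt_eqF// ltr_wpDr// mulrn_wge0.
Qed.

Lemma J1 v : J v -> step_nodes J [:: (1 : R, v)].
Proof. by move=> Jv p; rewrite inE => /eqP->. Qed.

Lemma J2 u v : J u -> J v -> step_nodes J [:: (1 : R, v); (1 : R, u)].
Proof. by move=> Ju Jv p; rewrite !inE => /orP[] /eqP->. Qed.

(** For x^2 / 2 the second derivative is 1 and the integrand deterministic. As 1_u may vanish at t,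
    the formula is read for 1_v with v > t and for 1_v + 1_u, and the results are subtracted. *)
Lemma integrable_kernels t u : J t -> J u ->
  rintegrable mu `[0, 1] (fun v => K t v * K u v).
Proof.
move=> Jt Ju; have [v [Jv tv uv]] := exists_later Jt Ju.
have sq := smooth_quadratic_family 1 0 : smooth_family (quadratic_family (1 : R) 0).
have Itv : rintegrable mu `[0, 1] (fun x => K t x * K v x).
  have [_ A _] := ibp_smooth_family sq Jt (J1 Jv).
  have I1 : rintegrable mu `[0, 1] (fun x => \sum_(p <- [:: (1 : R, v)])
      1 * step_val [:: (1 : R, v)] t * p.1 * (K t x * K p.2 x)).
    by apply: ae_cst; exact: A.
  move: I1; apply: eq_integrable => // x _.
  by rewrite /= big_seq1 step_val1//= !mul1r.
have [_ A _] := ibp_smooth_family sq Jt (J2 Ju Jv).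
have c0 := step_val2_neq0 u Jt tv; set c := step_val _ _ in c0 A.
have I1 : rintegrable mu `[0, 1] (fun x => \sum_(p <- [:: (1 : R, v); (1 : R, u)])
    1 * c * p.1 * (K t x * K p.2 x)).
  by apply: ae_cst; exact: A.
have m01 : measurable (`[0, 1]%classic : set (measurableTypeR R)) by exact: measurable_itv.
have I2 := rintegrableZ m01 c^-1 I1.
have I3 := rintegrableZ m01 (-1) Itv.
have := rintegrableD m01 I2 I3.
apply: eq_integrable => // x _; congr EFin.
by rewrite !big_cons big_nil/= addr0; field.
Qed.

Lemma ibp_expectation (F : nat -> R -> R) (t : R) (s : step R R) :
  smooth_family F -> J t -> step_nodes J s -> step_val s t != 0 ->
  rintegrable P setT (fun w => F 2%N (step_int s (X ^~ w))) ->
  rintegrable P setT (fun w => X t w * F 1%N (step_int s (X ^~ w))) /\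
  \int[P]_w (X t w * F 1%N (step_int s (X ^~ w))) =
  (\sum_(p <- s) p.1 * cov t p.2) * \int[P]_w F 2%N (step_int s (X ^~ w)).
Proof.
move=> sF Jt Js c0 IF2; have [L _ E] := ibp_smooth_family sF Jt Js.
set c := step_val s t in c0 L E.
have IL : rintegrable P setT (fun w => X t w * F 1%N (step_int s (X ^~ w))).
  have := rintegrableZ measurableT c^-1 L; apply: eq_integrable => // w _.
  by rewrite /= mulKf.
split=> //; apply: (mulfI c0).
transitivity (\int[P]_w (c * (X t w * F 1%N (step_int s (X ^~ w))))).
  by rewrite RintegralZl.
rewrite E.
transitivity (\int[P]_w (c * (\sum_(p <- s) p.1 * cov t p.2) * F 2%N (step_int s (X ^~ w)))).
  apply: eq_Rintegral => w _; rewrite Rintegral_sum//; last first.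
    by move=> p /Js Jp; apply: rintegrableZ => //; exact: integrable_kernels.
  rewrite [RHS]mulrAC [RHS]mulr_sumr big_seq [RHS]big_seq; apply: eq_bigr => p /Js Jp.
  by rewrite RintegralZl//; [rewrite /cov /fredholm_cov; ring|exact: integrable_kernels].
by rewrite RintegralZl// mulrA.
Qed.

Lemma ibp_mean0 t : J t -> rintegrable P setT (X t) /\ \int[P]_w X t w = 0.
Proof.
move=> Jt; have [v [Jv tv _]] := exists_later Jt Jt.
have [] := ibp_expectation (smooth_quadratic_family 0 1) Jt (J1 Jv).
- by rewrite step_val1// oner_neq0.
- exact: (finite_measure_integrable_cst P 0 measurableT).
move=> I1 E1; split.
  by move: I1; apply: eq_integrable => // w _; rewrite /= mul0r add0r mulr1.
transitivity (\int[P]_w (X t w * quadratic_family 0 1 1 (step_int [:: (1, v)] (X ^~ w)))).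
  by apply: eq_Rintegral => w _; rewrite /= mul0r add0r mulr1.
by rewrite E1 /= Rintegral_cst// mul0r mulr0.
Qed.

(** The subtraction of [integrable_kernels], now for expectations: the first derivative of x^2 / 2
    brings the integral itself next to X t. *)
Lemma ibp_covariance t u : J t -> J u ->
  rintegrable P setT (fun w => X t w * X u w) /\
  \int[P]_w (X t w * X u w) = cov t u.
Proof.
move=> Jt Ju; have [v [Jv tv uv]] := exists_later Jt Ju.
have sq := smooth_quadratic_family 1 0 : smooth_family (quadratic_family (1 : R) 0).
have I1 : rintegrable P setT (fun=> 1 : R).
  exact: (finite_measure_integrable_cst P 1 measurableT).
have [Iv Ev] : rintegrable P setT (fun w => X t w * X v w) /\
    \int[P]_w (X t w * X v w) = cov t v.
  have E w : X t w * quadratic_family 1 0 1 (step_int [:: (1, v)] (X ^~ w)) =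
      X t w * X v w.
    by rewrite /step_int /step_lin /quadratic_family big_seq1/=; ring.
  have [] := ibp_expectation sq Jt (J1 Jv) _ I1; first by rewrite step_val1// oner_neq0.
  under eq_fun do rewrite E.
  by rewrite big_seq1 /= mul1r Rintegral_probability_cst mulr1.
have E w : X t w * quadratic_family 1 0 1 (step_int [:: (1, v); (1, u)] (X ^~ w)) =
    X t w * X v w + X t w * X u w.
  by rewrite /step_int /step_lin /quadratic_family !big_cons big_nil/=; ring.
have [] := ibp_expectation sq Jt (J2 Ju Jv) (step_val2_neq0 u Jt tv) I1.
under eq_fun do rewrite E.
rewrite !big_cons big_nil /= !mul1r addr0 Rintegral_probability_cst mulr1.
move=> I2 E2.
have Iu : rintegrable P setT (fun w => X t w * X u w).
  have := rintegrableD measurableT I2 (rintegrableZ measurableT (-1) Iv).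
  by apply: eq_integrable => // w _ /=; congr EFin; ring.
split=> //; move: E2; rewrite RintegralD// Ev.
exact: addrI.
Qed.

End IbpToGaussian.

(** * The characteristic function determines the law *)

Section CharacteristicUniqueness.
Context (R : realType) d (T : measurableType d) (P : probability T R).
Variables (W : T -> R) (mW : measurable_fun setT W).
Variable Q : probability (measurableTypeR R) R.
Hypothesis eq_cos : forall t,
  \int[P]_w cos (t * W w) = \int[Q]_x cos (t * x).
Hypothesis eq_sin : forall t,
  \int[P]_w sin (t * W w) = \int[Q]_x sin (t * x).

(** Boundedness is part of the class so that linear combinations and uniformly bounded pointwise
    limits stay in it. *)
Definition same_expectation (f : measurableTypeR R -> R) := [/\ measurable_fun setT f,
  exists M : R, forall x, `|f x| <= M & \int[P]_w f (W w) = \int[Q]_x f x].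

Let intP (f : measurableTypeR R -> R) : measurable_fun setT f ->
  (exists M : R, forall x, `|f x| <= M) -> rintegrable P setT (f \o W).
Proof.
move=> mf [M fM]; apply: (@rintegrable_bounded _ _ _ P _ M).
  exact: (measurableT_comp mf mW).
by move=> w; exact: fM.
Qed.

Let intQ (f : measurableTypeR R -> R) : measurable_fun setT f ->
  (exists M : R, forall x, `|f x| <= M) -> rintegrable Q setT f.
Proof. by move=> mf [M fM]; exact: (@rintegrable_bounded _ _ _ Q _ M). Qed.

Lemma same_expectation_lin a b f g : same_expectation f -> same_expectation g ->
  same_expectation (fun x => a * f x + b * g x).
Proof.
move=> [mf bf Ef] [mg bg Eg]; split.
- by apply: measurable_funD; exact: measurable_funM.
- have [M fM] := bf; have [N gN] := bg; exists (`|a| * M + `|b| * N) => x.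
  by rewrite (le_trans (ler_normD _ _))// !normrM lerD// ler_wpM2l.
- have [If Ig] := (intP mf bf, intP mg bg).
  have [Jf Jg] := (intQ mf bf, intQ mg bg).
  rewrite RintegralD//; [|exact: (rintegrableZ _ _ If)|exact: (rintegrableZ _ _ Ig)].
  rewrite [RHS]RintegralD//; [|exact: rintegrableZ|exact: rintegrableZ].
  by rewrite !RintegralZl// ?Ef ?Eg.
Qed.

Lemma same_expectation_cvg (f_ : nat -> measurableTypeR R -> R) f M :
  (forall n, same_expectation (f_ n)) -> (forall n x, `|f_ n x| <= M) ->
  (forall x, f_ n x @[n --> \oo] --> f x) -> same_expectation f.
Proof.
move=> S fM cf.
have mf : measurable_fun setT f.
  by apply: (@measurable_fun_cvg _ _ _ setT f_) => [n|x _]; [case: (S n)|exact: cf].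
have bf x : `|f x| <= M.
  have cn : `|f_ n x| @[n --> \oo] --> `|f x| by apply: cvg_norm; exact: cf.
  rewrite -(cvg_lim _ cn)//; apply: limr_le; first by apply/cvg_ex; exists `|f x|.
  by apply: nearW => n; exact: fM.
split=> //; first by exists M.
have [|_ c1] := @rdominated_cvg _ _ _ P setT measurableT
  (fun n => f_ n \o W) (f \o W) (fun=> M) _ (fun w _ => cf (W w)) (fun n w _ => fM n (W w))
  (finite_measure_integrable_cst P M measurableT).
  by move=> n; have [mfn _ _] := S n; exact: (measurableT_comp mfn mW).
have [|_ c2] := @rdominated_cvg _ _ _ Q setT measurableT
  f_ f (fun=> M) _ (fun w _ => cf w) (fun n w _ => fM n w)
  (finite_measure_integrable_cst Q M measurableT).
  by move=> n; case: (S n).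
apply: (@cvg_unique _ (@Rhausdorff R) _ _ _ _ c1).
rewrite (_ : (fun n => _) = fun n => \int[Q]_x f_ n x)//.
by apply/funext => n; case: (S n).
Qed.

(* As for Stein pairs, multiplication by trigonometric monomials is built in. *)
Definition mul_same_expectation f := forall t u,
  same_expectation (fun x => f x * cos (t * x + u)).

Lemma mul_same_expectation1 : mul_same_expectation (fun=> 1).
Proof.
move=> t u.
have mt : measurable_fun setT (fun x : R => t * x) by exact: measurable_funM.
have Sc : same_expectation (fun x => cos (t * x)).
  split=> //; first exact: (measurableT_comp (@measurable_cos R)).
  by exists 1 => x; rewrite normr_cos_le1.
have Ss : same_expectation (fun x => sin (t * x)).
  split=> //; first exact: (measurableT_comp (@measurable_sin R)).
  by exists 1 => x; rewrite normr_sin_le1.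
have := same_expectation_lin (cos u) (- sin u) Sc Ss; congr same_expectation.
by apply/funext => x; rewrite cosD; ring.
Qed.

Lemma mul_same_expectation_lin a b f g :
  mul_same_expectation f -> mul_same_expectation g ->
  mul_same_expectation (fun x => a * f x + b * g x).
Proof.
move=> Sf Sg t u; have := same_expectation_lin a b (Sf t u) (Sg t u).
by congr same_expectation; apply/funext => x; ring.
Qed.

Lemma mul_same_expectation_sin a f : mul_same_expectation f ->
  mul_same_expectation (fun x => sin (a * x) * f x).
Proof.
move=> Sf t u.
(* The phase - pi / 2 turns cosines into sines, and sin a cos b = (sin (b + a) - sin (b - a)) /
   2. *)
have := same_expectation_lin 2^-1 (- 2^-1) (Sf (t + a) (u - pi / 2)) (Sf (t - a) (u - pi / 2)).
congr same_expectation; apply/funext => x.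
have E b : cos (b * x + (u - pi / 2)) = sin (b * x + u) :> R.
  by rewrite addrA cosB cos_pihalf sin_pihalf mulr0 mulr1 add0r.
rewrite !E; have -> : (t + a) * x + u = (t * x + u) + a * x by ring.
have -> : (t - a) * x + u = (t * x + u) - a * x by ring.
by rewrite sinD sinB; field.
Qed.

Let theta a (x : R) := (1 + sin (a * x)) / 2.

Lemma mul_same_expectation_bernstein a N (f : nat -> R) :
  mul_same_expectation (fun x => bernstein N f (theta a x)).
Proof.
have S0 c : mul_same_expectation (fun=> c).
  have := mul_same_expectation_lin c 0 mul_same_expectation1 mul_same_expectation1.
  by congr mul_same_expectation; apply/funext => x; ring.
have Sth g : mul_same_expectation g -> mul_same_expectation (fun x => theta a x * g x).
  move=> Sg.
  have := mul_same_expectation_lin 2^-1 2^-1 Sg (mul_same_expectation_sin a Sg).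
  by congr mul_same_expectation; apply/funext => x; rewrite /theta; field.
elim: N f => [|N IHN] f /=; first exact: S0.
have := mul_same_expectation_lin 1 1 (Sth _ (IHN (f \o succn)))
  (mul_same_expectation_lin 1 (-1) (IHN f) (Sth _ (IHN f))).
by congr mul_same_expectation; apply/funext => x; ring.
Qed.

Lemma same_expectation_continuous (h : R -> R) (M : R) : continuous h ->
  (forall x, `|h x| <= M) -> same_expectation h.
Proof.
move=> ch hM.
apply: (same_expectation_cvg (f_ := fun m x => h (m.+1%:R * sin (m.+1%:R^-1 * x)))
  (M := M)) => //; last first.
  by move=> x; exact: (cvg_comp _ h (@cvg_sin_rescaled R x) (ch x)).
move=> m; set L := m.+1%:R.
(* h on [-L, L], rescaled to the unit interval: at theta with a = 1 / L it takes the value h (L sin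
   (x / L)). *)
pose k y := h (L * (2 * y - 1)).
have ck : continuous k.
  move=> y; apply: (@continuous_comp _ _ _ (fun y : R => L * (2 * y - 1)) h); last exact: ch.
  apply: cvgMr; apply: cvgB; last exact: cvg_cst.
  by apply: cvgMr; exact: cvg_id.
have kM y : `|k y| <= M by exact: hM.
have th01 x : 0 <= theta L^-1 x <= 1.
  rewrite /theta; have := @sin_geN1 R (L^-1 * x); have := @sin_le1 R (L^-1 * x).
  by move=> *; apply/andP; split; lra.
apply: (same_expectation_cvg (M := M)
  (f_ := fun N x => bernstein N (fun j => k (j%:R / N%:R)) (theta L^-1 x))).
- move=> N; have := mul_same_expectation_bernstein L^-1 N (fun j => k (j%:R / N%:R)) 0 0.
  by congr same_expectation; apply/funext => x; rewrite mul0r addr0 cos0 mulr1.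
- by move=> N x; apply: bernstein_norm_le.
- move=> x; have := bernstein_continuous_cvg (th01 x) (fun t _ => kM t) (ck (theta L^-1 x)).
  by rewrite {2}/k /theta; congr (_ --> h _); field.
Qed.

Lemma same_expectation_ray (a : R) : same_expectation (\1_(`]-oo, a]%classic : set R)).
Proof.
(* For m > 0, equal to 1 up to a and falling linearly to 0 over an interval of length 1 / m. *)
pose f (m : nat) (x : R) : R := Num.max 0 (Num.min 1 (1 - m%:R * (x - a))).
have f01 m x : 0 <= f m x <= 1.
  by rewrite /f le_max lexx/= ge_max ler01 ge_min lexx.
apply: (same_expectation_cvg (f_ := f) (M := 1)).
- move=> m; apply: (same_expectation_continuous (M := 1)).
    move=> x; have cg : {for x, continuous (fun x : R => 1 - m%:R * (x - a))}.
      apply: cvgB; first exact: cvg_cst.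
      by apply: cvgMr; apply: cvgB; [exact: cvg_id|exact: cvg_cst].
    have c0 : {for x, continuous (fun=> 0 : R)} by exact: cvg_cst.
    have c1 : {for x, continuous (fun=> 1 : R)} by exact: cvg_cst.
    exact: (continuous_max c0 (continuous_min c1 cg)).
  by move=> x; have /andP[h0 h1] := f01 m x; rewrite ger0_norm.
- by move=> m x; have /andP[h0 h1] := f01 m x; rewrite ger0_norm.
- move=> x; rewrite indicE; apply: cvg_near_cst.
  have [xa|ax] := leP x a.
    apply: nearW => m; rewrite mem_set/= ?in_itv//= /f.
    by rewrite min_l ?max_r// lerDl oppr_ge0 mulr_ge0_le0// subr_le0.
  rewrite memNset/= ?in_itv/=; last by apply/negP; rewrite -ltNge.
  near=> m; rewrite /f min_r ?max_l//.
    rewrite subr_le0 -ler_pdivrMr ?subr_gt0// mul1r.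
    by near: m; exact: nbhs_infty_ger.
  by rewrite gerBl mulr_ge0// subr_ge0 ltW.
Unshelve. all: by end_near. Qed.

(** Indicators of half-open intervals are differences of ray indicators, and these intervals form a
    pi-system that generates the Borel sets. *)
Theorem charfun_unique (A : set (measurableTypeR R)) : measurable A ->
  pushforward P (W : T -> measurableTypeR R) A = Q A.
Proof.
have law (B : set (measurableTypeR R)) : measurable B -> same_expectation \1_B ->
    pushforward P (W : T -> measurableTypeR R) B = Q B.
  move=> mB [_ _ E]; have mWB : measurable (W @^-1` B).
    by rewrite -[X in measurable X]setTI; exact: mW.
  have EP : (pushforward P (W : T -> measurableTypeR R) B)%E = (\int[P]_w (\1_B (W w)))%:E.
    rewrite /Rintegral fineK; last first.
      by apply: integrable_fin_num => //; apply: (@intP \1_B) => //; exists 1 => x;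
         rewrite indicE; case: (_ \in _); rewrite ?normr1 ?normr0.
    by rewrite (_ : (fun w => _) = fun w => (\1_(W @^-1` B) w)%:E)// integral_indic// setIT.
  have EQ : Q B = (\int[Q]_x \1_B x)%:E.
    rewrite /Rintegral fineK; last first.
      by apply: integrable_fin_num => //; apply: (@intQ \1_B) => //; exists 1 => x;
         rewrite indicE; case: (_ \in _); rewrite ?normr1 ?normr0.
    by rewrite integral_indic// setIT.
  by rewrite EP EQ E.
have lawI a b : same_expectation \1_(`]a, b]%classic : set R).
  have [ab|ba] := leP a b; last first.
    have -> : \1_(`]a, b]%classic : set R) = (fun x => 0 * \1_(`]-oo, b]%classic : set R) x +
        0 * \1_(`]-oo, a]%classic : set R) x) :> (R -> R).
      apply/funext => x; rewrite !mul0r addr0 set_itv_ge ?indic0//.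
      by rewrite bnd_simp -leNgt ltW.
    by apply: same_expectation_lin; exact: same_expectation_ray.
  have -> : \1_(`]a, b]%classic : set R) = (fun x => 1 * \1_(`]-oo, b]%classic : set R) x +
      -1 * \1_(`]-oo, a]%classic : set R) x) :> (R -> R).
    apply/funext => x; rewrite !indicE !mem_setE !in_itv/=.
    have [xa|ax] := leP x a; first by rewrite (le_trans xa ab)/=; ring.
    by case: (x <= b) => /=; ring.
  by apply: same_expectation_lin; exact: same_expectation_ray.
have mW' : measurable_fun setT (W : T -> measurableTypeR R) by [].
pose nu : {measure set (measurableTypeR R) -> \bar R} :=
  measure_function_pushforward__canonical__measure_function_Measure P mW'.
have ocI : setI_closed (@ocitv R) by exact: ocitvI.
have g_cover : \bigcup_k `]- k%:R, k%:R]%classic = [set: R].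
  rewrite -subTset => x _; exists (Num.truncn `|x|).+1 => //=.
  by have := truncnS_gt `|x|; rewrite ltr_norml in_itv/= => /andP[-> /ltW->].
have Gg k : (@ocitv R) `]- k%:R, k%:R]%classic by exact: is_ocitv.
apply: (@measure_unique _ R (measurableTypeR R) (@ocitv R) _ erefl ocI Gg g_cover nu Q).
- move=> B [[a b] _ <-]; apply: law; last exact: lawI.
  exact: measurable_itv.
- move=> k; have mk : measurable (W @^-1` `]- k%:R, k%:R]).
    by rewrite -[X in measurable X]setTI; apply: mW => //; exact: measurable_itv.
  exact: (le_lt_trans (probability_le1 P mk) (ltry 1)).
Qed.

End CharacteristicUniqueness.

(** * The law of a step integral under the formula *)

Section IbpLaw.
Context (R : realType) d (T : measurableType d) (P : probability T R).
Variables (K : R -> R -> R) (X : R -> T -> R).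
Notation J := (`]0, 1[%classic : set R).
Hypothesis ibp : malliavin_ibp P J K X.
Hypothesis mX : forall t, J t -> measurable_fun setT (X t).

Let cov := fredholm_cov K.
Let covs t (s : step R R) := \sum_(p <- s) p.1 * cov t p.2.

Lemma measurable_step_int (s : step R R) : step_nodes J s ->
  measurable_fun setT (fun w => step_int s (X ^~ w)).
Proof.
rewrite /step_int /step_lin; elim: s => [|p s IHs] sJ.
  by under eq_fun do rewrite big_nil; exact: measurable_cst.
under eq_fun do rewrite big_cons; apply: measurable_funD.
  by apply: measurable_funM => //; apply: mX; apply: sJ; rewrite mem_head.
by apply: IHs => q qs; apply: sJ; rewrite inE qs orbT.
Qed.

(** For the functional cos (lam W + u) the two derivatives carry the factors - lam and - lam^2, so
    one factor - lam is cancelled. *)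
Lemma ibp_trig_neq0 t s lam u : J t -> step_nodes J s -> step_val s t != 0 -> lam != 0 ->
  \int[P]_w (X t w * sin (lam * step_int s (X ^~ w) + u)) =
  lam * covs t s * \int[P]_w cos (lam * step_int s (X ^~ w) + u).
Proof.
move=> Jt Js c0 l0.
have mc : measurable_fun setT (fun w => cos (lam * step_int s (X ^~ w) + u)).
  apply: (measurableT_comp (@measurable_cos R)).
  by apply: measurable_funD => //; apply: measurable_funM => //; exact: measurable_step_int.
have Ic : rintegrable P setT (fun w => cos (lam * step_int s (X ^~ w) + u)).
  by apply: (@rintegrable_bounded _ _ _ P _ 1) => // w; rewrite normr_cos_le1.
have [] := ibp_expectation ibp (smooth_cosine_family lam u) Jt Js c0.
  by under eq_fun do rewrite cosine_family2; exact: rintegrableZ.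
have E w : X t w * cosine_family lam u 1 (step_int s (X ^~ w)) =
    - lam * (X t w * sin (lam * step_int s (X ^~ w) + u)).
  by rewrite cosine_family1; ring.
under eq_fun do rewrite E; under [X in _ -> _ = _ * X -> _]eq_Rintegral do rewrite cosine_family2.
move=> I1; have I2 : rintegrable P setT (fun w => X t w * sin (lam * step_int s (X ^~ w) + u)).
  have := rintegrableZ measurableT (- lam^-1) I1; apply: eq_integrable => // w _ /=.
  by congr EFin; field.
rewrite !RintegralZl// -/(covs t s) => E2.
apply: (@mulfI _ (- lam)); first by rewrite oppr_eq0.
by rewrite E2; ring.
Qed.

Lemma ibp_trig t s lam u : J t -> step_nodes J s ->
  \int[P]_w (X t w * sin (lam * step_int s (X ^~ w) + u)) =
  lam * covs t s * \int[P]_w cos (lam * step_int s (X ^~ w) + u).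
Proof.
move=> Jt Js; have [It Et] := ibp_mean0 ibp Jt.
(* For lam = 0 the left side is sin u times the mean of X t, hence 0. *)
have [->|l0] := eqVneq lam 0.
  under eq_Rintegral do rewrite mul0r add0r mulrC.
  by rewrite RintegralZl// Et mulr0 !mul0r.
have [s0|] := eqVneq (step_val s t) 0; last by move=> ?; exact: ibp_trig_neq0.
(* Adding [1_v / m] with [v > t] makes the step function nonzero at [t]. *)
have [v [Jv tv _]] := exists_later Jt Jt.
pose s_ (m : nat) : step R R := (m.+1%:R^-1, v) :: s.
have s_J m : step_nodes J (s_ m) by move=> p; rewrite inE => /predU1P[->//|/Js].
have s_neq0 m : step_val (s_ m) t != 0.
  have tI : t \in `[0, v[ by move: Jt; rewrite /= !in_itv/= tv => /andP[/ltW->].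
  by rewrite /step_val /s_ big_cons /= tI mulr1n -/(step_val s t) s0 addr0 invr_eq0.
have WE m w : step_int (s_ m) (X ^~ w) = m.+1%:R^-1 * X v w + step_int s (X ^~ w).
  by rewrite /step_int /step_lin big_cons.
have covE m : covs t (s_ m) = m.+1%:R^-1 * cov t v + covs t s.
  by rewrite /covs big_cons.
have cW w : lam * step_int (s_ m) (X ^~ w) + u @[m --> \oo] -->
    lam * step_int s (X ^~ w) + u.
  apply: cvgD; last exact: cvg_cst.
  apply: cvgMr; rewrite (_ : (fun m => step_int _ _) = fun m =>
    m.+1%:R^-1 * X v w + step_int s (X ^~ w)); last by apply/funext => m; rewrite WE.
  rewrite -[X in _ --> X]add0r -{1}(mul0r (X v w)).
  by apply: cvgD; [apply: cvgMl; exact: cvg_harmonic|exact: cvg_cst].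
have mW m : measurable_fun setT (fun w => lam * step_int (s_ m) (X ^~ w) + u).
  by apply: measurable_funD => //; apply: measurable_funM => //; exact: measurable_step_int.
have [||||_ c1] := @rdominated_cvg _ _ _ P setT measurableT
  (fun m w => X t w * sin (lam * step_int (s_ m) (X ^~ w) + u))
  (fun w => X t w * sin (lam * step_int s (X ^~ w) + u)) (fun w => `|X t w|).
- move=> m; apply: measurable_funM; first exact: mX.
  exact: (measurableT_comp (@measurable_sin R)).
- move=> w _; apply: cvgMr.
  exact: (cvg_comp _ sin (cW w) (@continuous_sin R _)).
- by move=> m w _; rewrite normrM ler_piMr// normr_sin_le1.
- exact: rintegrable_norm.
have [||||_ c2] := @rdominated_cvg _ _ _ P setT measurableT
  (fun m w => cos (lam * step_int (s_ m) (X ^~ w) + u))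
  (fun w => cos (lam * step_int s (X ^~ w) + u)) (fun=> 1).
- by move=> m; exact: (measurableT_comp (@measurable_cos R)).
- by move=> w _; exact: (cvg_comp _ cos (cW w) (@continuous_cos R _)).
- by move=> m w _; rewrite normr_cos_le1.
- exact: (finite_measure_integrable_cst P 1 measurableT).
apply: (@cvg_unique _ (@Rhausdorff R) _ _ _ _ c1).
rewrite (_ : (fun m => _) = fun m => lam * covs t (s_ m) *
    \int[P]_w cos (lam * step_int (s_ m) (X ^~ w) + u)); last first.
  by apply/funext => m; rewrite ibp_trig_neq0.
apply: cvgM c2; apply: cvgMr.
rewrite (_ : (fun m => _) = fun m => m.+1%:R^-1 * cov t v + covs t s); last first.
  by apply/funext => m; rewrite covE.
rewrite -[X in _ --> X]add0r -{1}(mul0r (cov t v)).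
by apply: cvgD; [apply: cvgMl; exact: cvg_harmonic|exact: cvg_cst].
Qed.

Lemma ibp_centered_gaussian_rv (s : step R R) : step_nodes J s ->
  centered_gaussian_rv P (fun w => step_int s (X ^~ w)).
Proof.
move=> sJ; set W := fun w => _.
have mW : measurable_fun setT W by exact: measurable_step_int.
pose v := \sum_(p <- s) p.1 * covs p.2 s.
have IXX (p q : R * R) : p \in s -> q \in s ->
    rintegrable P setT (fun w => X p.2 w * X q.2 w).
  by move=> /sJ Jp /sJ Jq; case: (ibp_covariance ibp Jp Jq).
(* As the second moment of W, the double sum v of covariances is nonnegative and has a square root
   to serve as standard deviation. *)
have vE : v = \int[P]_w W w ^+ 2.
  transitivity (\int[P]_w \sum_(p <- s) \sum_(q <- s) p.1 * q.1 * (X p.2 w * X q.2 w)).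
    rewrite Rintegral_sum//; last first.
      move=> p ps; apply: rintegrable_sum => // q qs; apply: rintegrableZ => //.
      exact: IXX.
    rewrite /v big_seq [RHS]big_seq; apply: eq_bigr => p ps.
    rewrite Rintegral_sum//; last first.
      by move=> q qs; apply: rintegrableZ => //; exact: IXX.
    rewrite /covs mulr_sumr big_seq [RHS]big_seq; apply: eq_bigr => q qs.
    rewrite RintegralZl//; last exact: IXX.
    by case: (ibp_covariance ibp (sJ _ ps) (sJ _ qs)) => _ ->; rewrite mulrA.
  apply: eq_Rintegral => w _; rewrite expr2 /W /step_int /step_lin mulr_suml.
  apply: eq_bigr => p _; rewrite mulr_sumr; apply: eq_bigr => q _.
  by ring.
have v0 : 0 <= v by rewrite vE Rintegral_ge0// => w _; exact: sqr_ge0.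
have IX p : p \in s -> rintegrable P setT (X p.2).
  by move=> /sJ Jp; case: (ibp_mean0 ibp Jp).
have IW : rintegrable P setT W.
  by apply: rintegrable_sum => // p ps; apply: rintegrableZ => //; exact: IX.
have trig lam u : \int[P]_w (W w * sin (lam * W w + u)) =
    v * lam * \int[P]_w cos (lam * W w + u).
  have msin : measurable_fun setT (fun w => sin (lam * W w + u)).
    apply: (measurableT_comp (@measurable_sin R)).
    by apply: measurable_funD => //; exact: measurable_funM.
  have IXs p : p \in s -> rintegrable P setT (fun w => X p.2 w * sin (lam * W w + u)).
    move=> ps; apply: (rintegrable_le measurableT _ _ (rintegrable_norm measurableT (IX p ps))).
      by apply: measurable_funM => //; exact/mX/sJ.
    by move=> w _; rewrite normrM ler_piMr// normr_sin_le1.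
  transitivity (\int[P]_w \sum_(p <- s) p.1 * (X p.2 w * sin (lam * W w + u))).
    apply: eq_Rintegral => w _; rewrite {1}/W /step_int /step_lin mulr_suml.
    by apply: eq_bigr => p _; rewrite mulrA.
  rewrite Rintegral_sum//; last first.
    by move=> p ps; apply: rintegrableZ => //; exact: IXs.
  rewrite /v !mulr_suml big_seq [RHS]big_seq; apply: eq_bigr => p ps.
  rewrite RintegralZl//; last exact: IXs.
  by rewrite ibp_trig//; [ring|exact: sJ].
have [Hc Hs] : (forall t, \int[P]_w cos (t * W w) = expR (- (v * t ^+ 2 / 2))) /\
    (forall t, \int[P]_w sin (t * W w) = 0).
  suff H t : \int[P]_w cos (t * W w) = expR (- (v * t ^+ 2 / 2)) /\ \int[P]_w sin (t * W w) = 0.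
    by split=> t; case: (H t).
  apply: gaussian_charfun => //.
  (* The phases 0 and pi / 2 give the sine and cosine hypotheses of [gaussian_charfun]. *)
  - move=> {}t; have := trig t 0.
    under eq_Rintegral do rewrite addr0; under [X in _ = _ * X -> _]eq_Rintegral do rewrite addr0.
    by [].
  - move=> {}t; have := trig t (pi / 2).
    under eq_Rintegral do rewrite sinDpihalf.
    under [X in _ = _ * X -> _]eq_Rintegral do rewrite cosDpihalf -mulN1r.
    rewrite RintegralZl//; first by move=> ->; ring.
    apply: (@rintegrable_bounded _ _ _ P _ 1).
      by apply: (measurableT_comp (@measurable_sin R)); exact: measurable_funM.
    by move=> w; rewrite normr_sin_le1.
split=> //; have [vz|vnz] := eqVneq v 0.
  left => A mA.
  apply: (@charfun_unique _ _ _ P W mW (\d_(0 : measurableTypeR R))) => // t.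
  - have mt : measurable_fun setT (fun x : R => cos (t * x)).
      by apply: (measurableT_comp (@measurable_cos R)); exact: measurable_funM.
    by rewrite (Rintegral_dirac 0 mt).2 Hc vz mul0r mul0r oppr0 expR0 mulr0 cos0.
  - have mt : measurable_fun setT (fun x : R => sin (t * x)).
      by apply: (measurableT_comp (@measurable_sin R)); exact: measurable_funM.
    by rewrite (Rintegral_dirac 0 mt).2 Hs mulr0 sin0.
right; have vpos : 0 < Num.sqrt v by rewrite sqrtr_gt0 lt_neqAle eq_sym vnz.
exists (Num.sqrt v) => // A mA.
have s0 : Num.sqrt v != 0 by rewrite gt_eqF.
apply: (@charfun_unique _ _ _ P W mW (normal_prob 0 (Num.sqrt v))) => // t.
- by rewrite (normal_charfun s0 t).1 sqr_sqrtr// Hc.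
- by rewrite (normal_charfun s0 t).2 Hs.
Qed.

Theorem ibp_fredholm_gaussian : gaussian_with_fredholm_kernel P J K X.
Proof.
split=> [n t a Jt|t s Jt Js].
  have sJ : step_nodes J [seq (a i, t i) | i <- enum 'I_n].
    by move=> p /mapP[i _ ->]; exact: Jt.
  have := ibp_centered_gaussian_rv sJ; congr centered_gaussian_rv.
  by apply/funext => w; rewrite /step_int /step_lin big_map big_enum.
split; first exact: (integrable_kernels ibp Jt Js).
have [Its Ets] := ibp_covariance ibp Jt Js.
rewrite unlock; move: Ets; rewrite /cov /fredholm_cov /Rintegral => Ets.
rewrite -[LHS]fineK ?integrable_fin_num//.
rewrite -[RHS]fineK ?Ets// integrable_fin_num//.
exact: (integrable_kernels ibp Jt Js).
Qed.

End IbpLaw.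

Lemma measurable_coordinate_process (R : realType) (X : R -> Omega R -> R) t :
  coordinate_process X -> `[0, 1]%classic t -> measurable_fun setT (X t).
Proof.
move=> [mX _] t01.
have mp : measurable_fun setT (fun w : Omega R => ((t : measurableTypeR R), w)).
  exact: pair1_measurable.
apply: (measurable_comp _ _ mX mp); last by move=> _ [w _ <-].
by apply: measurableX => //; exact: measurable_itv.
Qed.

Theorem theorem4p1 (R : realType) (K : R -> R -> R) (P : probability (Omega R) R)
    (X : R -> Omega R -> R) :
  L2kernel K -> coordinate_process X ->
  (gaussian_with_fredholm_kernel P `[0, 1] K X ->
   malliavin_ibp P `[0, 1] K X) /\
  (gaussian_with_fredholm_kernel P `]0, 1[ K X <->
   malliavin_ibp P `]0, 1[ K X).
Proof.
move=> _ cX; split; first exact: fredholm_gaussian_ibp.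
split; first exact: fredholm_gaussian_ibp.
move=> ibp; apply: ibp_fredholm_gaussian => // t t01.
apply: measurable_coordinate_process => //.
by move: t01; rewrite /= !in_itv/= => /andP[/ltW-> /ltW->].
Qed.
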